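(* Let $\mathsf G$ be an integral form of a connected reductive algebraic group, $n$ a homological degree, $l$ a prime, and let $p\neq l$ be a prime or zero. Let $k$ range over the algebraically closed fields of characteristic $p$. Then one of the following two possibilities obtains: (1) all the groups $H_n(\mathsf G(k),\mathbb Z/l)$ are countable, all the groups $\mathsf G(k)$ possess the same isoperimetric function (in homological degree $n$ with coefficients $\mathbb Z/l$), and moreover every extension $k\to K$ between algebraically closed fields of characteristic $p$ induces an isomorphism $H_n(\mathsf G(k),\mathbb Z/l)\to H_n(\mathsf G(K),\mathbb Z/l)$; or (2) $H_n(\mathsf G(k),\mathbb Z/l)$ has the cardinality of $k$ for all uncountable algebraically closed fields $k$ of characteristic $p$.
   Context: An integral form $\mathsf G$ of a connected reductive algebraic group is such an algebraic group given as a group scheme defined over the integers; for a field $k$, $\mathsf G(k)$ is its group of $k$-rational points, regarded as a discrete group, and $H_n(\mathsf G(k),\mathbb Z/l)$ is ordinary group homology with trivial coefficients. Bar complex. For a discrete group $G$ and trivial coefficients $R=\mathbb Z/l$, $C_n(G)$ is the free $R$-module on the set $G^n$, with boundary map $d_n:C_n(G)\to C_{n-1}(G)$ given on basis elements by $$d_n\langle g_1,\dots,g_n\rangle=\langle g_2,\dots,g_n\rangle+\sum_{i=1}^{n-1}(-1)^i\langle g_1,\dots,g_ig_{i+1},\dots,g_n\rangle+(-1)^n\langle g_1,\dots,g_{n-1}\rangle .$$ Its homology is $H_*(G,R)$, and $B_n(G)=\operatorname{im} d_{n+1}$. The size $\|c\|$ of $c\in C_n(G)$ is the number of elements of $G^n$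 occurring in $c$ with non-zero coefficient. For $b\in B_n(G)$ the filler norm is $$\|b\|_{\mathrm{fill}}=\min\{\|c\| : c\in C_{n+1}(G),\ d_{n+1}(c)=b\}.$$ $G$ satisfies a homological isoperimetric inequality in degree $n$ with coefficients $R$ if for every $K\in\mathbb N$, $$\mathrm{isop}(K):=\sup\{\|b\|_{\mathrm{fill}} : b\in B_n(G),\ \|b\|=K\}<\infty ,$$ and $\mathrm{isop}:\mathbb N\to\mathbb N$ is then called the (homological) isoperimetric function of $G$; to say that $G$ possesses an isoperimetric function means that $\mathrm{isop}(K)$ is finite for all $K$. *)

(* Defs.v *)
From HB Require Import structures.
From mathcomp Require Import all_boot all_order all_algebra finmap.
From mathcomp Require Import boolp classical_sets cardinality.
From mathcomp Require Import monalg.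

Set Implicit Arguments.
Unset Strict Implicit.
Unset Printing Implicit Defensive.

Import GRing.Theory.

Local Open Scope ring_scope.
Local Open Scope quotient_scope.

Definition has_char (R : nzRingType) (p : nat) : Prop :=
  if p == 0%N then [pchar R] =i pred0 else p \in [pchar R].

Definition push (A R S : comPzRingType)
    (f : {rmorphism R -> S}) (x : {rmorphism A -> R}) : {rmorphism A -> S} :=
  f \o x.

(* An affine group scheme over Z, through its functor of points: a commutative
   ring A together with a group structure on Hom(A, R), natural in the
   commutative ring R.  By Yoneda's lemma this is the same datum as a
   commutative Hopf algebra structure on A over Z.  Naturality of the
   multiplication entails that of the unit and of the inverse. *)
Record affine_group_scheme := AffineGroupScheme {
  coord : comPzRingType;
  pt_one : forall R : comPzRingType, {rmorphism coord -> R};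
  pt_inv : forall R : comPzRingType,
    {rmorphism coord -> R} -> {rmorphism coord -> R};
  pt_mul : forall R : comPzRingType,
    {rmorphism coord -> R} -> {rmorphism coord -> R} -> {rmorphism coord -> R};
  pt_mulA : forall R : comPzRingType, associative (@pt_mul R);
  pt_mul1g : forall R : comPzRingType, left_id (pt_one R) (@pt_mul R);
  pt_mulg1 : forall R : comPzRingType, right_id (pt_one R) (@pt_mul R);
  pt_mulVg : forall R : comPzRingType,
    left_inverse (pt_one R) (@pt_inv R) (@pt_mul R);
  pt_mulgV : forall R : comPzRingType,
    right_inverse (pt_one R) (@pt_inv R) (@pt_mul R);
  pt_natural : forall (R S : comPzRingType) (f : {rmorphism R -> S})
      (x y : {rmorphism coord -> R}),
    push f (pt_mul x y) = pt_mul (push f x) (push f y)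
}.

Definition points (G : affine_group_scheme) (R : comPzRingType) : Type :=
  {rmorphism coord G -> R}.

HB.instance Definition _ (G : affine_group_scheme) (R : comPzRingType) :=
  gen_eqMixin (points G R).
HB.instance Definition _ (G : affine_group_scheme) (R : comPzRingType) :=
  gen_choiceMixin (points G R).
HB.instance Definition _ (G : affine_group_scheme) (R : comPzRingType) :=
  isGroup.Build (points G R) (@pt_mulA G R) (@pt_mul1g G R) (@pt_mulg1 G R)
    (@pt_mulVg G R) (@pt_mulgV G R).

Definition points_map (G : affine_group_scheme) (R S : comPzRingType)
    (f : {rmorphism R -> S}) (x : points G R) : points G S := push f x.

Arguments points_map G {R S} f x.

Lemma points_mapM (G : affine_group_scheme) (R S : comPzRingType)
    (f : {rmorphism R -> S}) :
  {morph @points_map G R S f : x y / (x * y)%g}.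
Proof. by move=> x y; exact: pt_natural. Qed.

HB.instance Definition _ (G : affine_group_scheme) (R S : comPzRingType)
    (f : {rmorphism R -> S}) :=
  monoid.isMultiplicative.Build (points G R) (points G S) (@points_map G R S f)
    (@points_mapM G R S f).

(* The coordinate ring is finitely generated: some finite subset is contained
   in no proper subring. *)
Definition finite_type (G : affine_group_scheme) : Prop :=
  exists s : seq (coord G), forall S : {pred coord G},
    subring_closed S -> {subset s <= S} -> forall a, a \in S.

Section LinearAlgebraicGroup.
Variables (G : affine_group_scheme) (F : closedFieldType).

Local Open Scope classical_set_scope.

(* The functions on G(F) defined by the elements \sum_i a_i (x) c_i of
   F[G] = coord G (x)_Z F. *)
Definition regular (h : points G F -> F) : Prop :=
  exists s : seq (F * coord G),
    forall x : points G F, h x = \sum_(ca <- s) ca.1 * (x : {rmorphism _ -> _}) ca.2.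

Definition zariski_closed (Z : set (points G F)) : Prop :=
  exists2 I : set (points G F -> F), I `<=` regular
    & Z = [set x | forall h, I h -> h x = 0].

Definition zariski_connected (Z : set (points G F)) : Prop :=
  forall U V : set (points G F), zariski_closed U -> zariski_closed V ->
    Z `<=` U `|` V -> Z `&` U `&` V = set0 -> Z `<=` U \/ Z `<=` V.

Definition subgroup (N : set (points G F)) : Prop :=
  [/\ N 1%g, forall x y, N x -> N y -> N (x * y)%g & forall x, N x -> N x^-1%g].

Definition normal_subgroup (N : set (points G F)) : Prop :=
  subgroup N /\ forall x g, N x -> N (x ^ g)%g.

(* Right translation by g is a locally unipotent endomorphism of F[G]: each
   regular function is killed by a power of rho_g - 1. *)
Definition unipotent (g : points G F) : Prop :=
  forall h, regular h ->
    exists m, iter m (fun (h' : points G F -> F) x => h' (x * g)%g - h' x) h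
              = (fun=> 0).

(* Connected, with trivial unipotent radical, in terms of the variety of
   F-points.  In characteristic 0 the base change of G to F is reduced
   (Cartier), so that it is determined by this variety. *)
Definition connected_reductive : Prop :=
  zariski_connected setT /\
  forall N : set (points G F), normal_subgroup N -> zariski_closed N ->
    zariski_connected N -> N `<=` unipotent -> N = [set 1%g].

End LinearAlgebraicGroup.

(* A group scheme over Z whose geometric generic fibre is a connected reductive
   algebraic group; nothing is required of the fibres at the primes. *)
Definition integral_form_of_connected_reductive (G : affine_group_scheme) :
    Prop :=
  finite_type G /\
  exists F : closedFieldType, has_char F 0 /\ connected_reductive G F.

Section LinearExtension.
Variables (R : nzRingType) (K : choiceType) (V : lmodType R) (h : K -> V).

Definition lin_ext (c : {malg R[K]}) : V := \sum_(x <- msupp c) c@_x *: h x.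

Lemma lin_extEw (D : {fset K}) (c : {malg R[K]}) :
  (msupp c `<=` D)%fset -> lin_ext c = \sum_(x <- D) c@_x *: h x.
Proof.
move=> sD; rewrite /lin_ext (big_fset_incl _ sD) // => x _ xNc.
by rewrite mcoeff_outdom // scale0r.
Qed.

Lemma lin_ext_is_linear : linear lin_ext.
Proof.
move=> a c c'; pose D := (msupp c `|` msupp c')%fset.
have sc : (msupp c `<=` D)%fset by exact: fsubsetUl.
have sc' : (msupp c' `<=` D)%fset by exact: fsubsetUr.
have sac : (msupp (a *: c + c') `<=` D)%fset.
  apply: (fsubset_trans (msuppD_le _ _)).
  by apply: fsetSU; exact: msuppZ_le.
rewrite (lin_extEw sc) (lin_extEw sc') (lin_extEw sac) scaler_sumr -big_split /=.
by apply: eq_bigr => x _; rewrite mcoeffD mcoeffZ scalerDl scalerA.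
Qed.

HB.instance Definition _ :=
  GRing.isLinear.Build R {malg R[K]} V *:%R lin_ext lin_ext_is_linear.

Lemma lin_extU (x : K) : lin_ext << x >> = h x.
Proof.
by rewrite (lin_extEw (msuppU_le (x := 1))) big_seq_fset1 mcoeffUU scale1r.
Qed.

End LinearExtension.

Lemma lin_ext_comp (R : nzRingType) (K : choiceType) (V W : lmodType R)
    (L : {linear V -> W}) (h : K -> V) (c : {malg R[K]}) :
  L (lin_ext h c) = lin_ext (L \o h) c.
Proof.
by rewrite /lin_ext linear_sum; apply: eq_bigr => x _; rewrite linearZ.
Qed.

Lemma eq_lin_ext (R : nzRingType) (K : choiceType) (V : lmodType R)
    (h h' : K -> V) : h =1 h' -> lin_ext h =1 lin_ext h'.
Proof. by move=> hh' c; apply: eq_bigr => x _; rewrite hh'. Qed.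

Section BarComplex.
Variables (R : nzRingType) (G : groupType).

Definition bar_chain (n : nat) := {malg R[n.-tuple G]}.

(* The i-th face of <g_1, ..., g_(n+1)>, for 0 <= i <= n+1.  The indices of g
   start from 0, so that the entry of index j is g_(j+1) if j+1 < i, is
   g_i g_(i+1) if j+1 = i, and is g_(j+2) if j+1 > i; for i = 0 this drops g_1
   and for i = n+1 it drops g_(n+1). *)
Definition bar_face (n : nat) (g : n.+1.-tuple G) (i : nat) : n.-tuple G :=
  [tuple (if (j.+1 < i)%N then nth 1 g j
          else if j.+1 == i then nth 1 g j * nth 1 g j.+1
          else nth 1 g j.+1)%g | j < n].

(* d_0 is the zero map, C_(-1) being zero. *)
Definition bar_d (n : nat) : bar_chain n -> bar_chain n.-1 :=
  match n with
  | 0 => fun=> 0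
  | m.+1 => lin_ext (fun g : m.+1.-tuple G =>
      \sum_(i < m.+2) (-1) ^+ i *: (<< bar_face g i >> : bar_chain m))
  end.

Lemma bar_d_is_zmod_morphism (n : nat) : zmod_morphism (@bar_d n).
Proof.
by case: n => [|n] x y /=; [rewrite subr0 | exact: raddfB].
Qed.

HB.instance Definition _ (n : nat) :=
  GRing.isZmodMorphism.Build (bar_chain n) (bar_chain n.-1) (@bar_d n)
    (@bar_d_is_zmod_morphism n).

Definition is_cycle (n : nat) : {pred bar_chain n} := [pred c | bar_d c == 0].

Definition is_boundary (n : nat) : {pred bar_chain n} :=
  [pred b | `[< exists c : bar_chain n.+1, bar_d c = b >]].

Lemma is_boundaryP (n : nat) (b : bar_chain n) :
  reflect (exists c : bar_chain n.+1, bar_d c = b) (b \in @is_boundary n).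
Proof. exact: asboolP. Qed.

Lemma is_cycle_zmod_closed (n : nat) : zmod_closed (@is_cycle n).
Proof.
split=> [|x y]; rewrite !inE ?raddf0 //.
by move=> /eqP x0 /eqP y0; rewrite raddfB /= x0 y0 subr0.
Qed.

HB.instance Definition _ (n : nat) :=
  GRing.isZmodClosed.Build (bar_chain n) (@is_cycle n)
    (@is_cycle_zmod_closed n).

Record bar_cycle (n : nat) := BarCycle {
  chain_of_cycle :> bar_chain n;
  cycleP : chain_of_cycle \in @is_cycle n
}.

HB.instance Definition _ (n : nat) := [isSub for @chain_of_cycle n].
HB.instance Definition _ (n : nat) := [Choice of bar_cycle n by <:].
HB.instance Definition _ (n : nat) :=
  [SubChoice_isSubZmodule of bar_cycle n by <:].

Definition cycle_boundary (n : nat) : {pred bar_cycle n} :=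
  [pred z : bar_cycle n | chain_of_cycle z \in @is_boundary n].

Lemma cycle_boundary_zmod_closed (n : nat) : zmod_closed (@cycle_boundary n).
Proof.
split=> [|x y]; rewrite !inE.
  by exists 0; rewrite raddf0.
move=> [c dc] [c' dc']; exists (c - c').
by rewrite (raddfB (@bar_d n.+1) c c' : bar_d (c - c') = bar_d c - bar_d c') dc dc'.
Qed.

HB.instance Definition _ (n : nat) :=
  GRing.isZmodClosed.Build (bar_cycle n) (@cycle_boundary n)
    (@cycle_boundary_zmod_closed n).

Definition homology (n : nat) : zmodType := Quotient.quot (@cycle_boundary n).

Definition homology_class (n : nat) (z : bar_cycle n) : homology n :=
  \pi_(Quotient.quot (@cycle_boundary n)) z.

Lemma homology_class_is_zmod_morphism (n : nat) :
  zmod_morphism (@homology_class n).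
Proof. by move=> x y; rewrite /homology_class raddfB. Qed.

HB.instance Definition _ (n : nat) :=
  GRing.isZmodMorphism.Build (bar_cycle n) (homology n) (@homology_class n)
    (@homology_class_is_zmod_morphism n).

Definition homology_repr (n : nat) (a : homology n) : bar_cycle n :=
  repr (a : Quotient.quot (@cycle_boundary n)).

Lemma homology_reprK (n : nat) (a : homology n) :
  homology_class (homology_repr a) = a.
Proof. exact: (@reprK _ (Quotient.quot (@cycle_boundary n)) a). Qed.

Lemma homology_class_eq (n : nat) (z z' : bar_cycle n) :
  homology_class z = homology_class z' <-> z - z' \in @cycle_boundary n.
Proof.
rewrite /homology_class; split=> [/eqP|]; first by rewrite eqmodE.
by move=> zz'; apply/eqP; rewrite eqmodE.
Qed.

End BarComplex.

Section HomologyMap.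
Variables (R : nzRingType) (G H : groupType) (f : {multiplicative G -> H}).

Definition chain_map (n : nat) : bar_chain R G n -> bar_chain R H n :=
  lin_ext (fun g => << map_tuple f g >>).

HB.instance Definition _ (n : nat) := GRing.Linear.on (@chain_map n).

Lemma chain_map_face (n : nat) (g : n.+1.-tuple G) (i : nat) :
  map_tuple f (bar_face g i) = bar_face (map_tuple f g) i.
Proof.
apply: eq_from_tnth => j; rewrite tnth_map !tnth_mktuple.
have nthE k : (k < n.+1)%N -> nth 1%g (map_tuple f g) k = f (nth 1%g g k).
  by move=> kn; rewrite (nth_map 1%g) ?size_tuple.
have jn := ltn_ord j; rewrite !nthE //; last exact: leqW.
by case: ifP => // _; case: ifP => // _; rewrite gmulfM.
Qed.

Lemma chain_map_d (n : nat) (c : bar_chain R G n) :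
  bar_d (chain_map c) = chain_map (bar_d c).
Proof.
case: n c => [|n] c; first by rewrite /= raddf0.
rewrite /bar_d /chain_map (lin_ext_comp (lin_ext _)) (lin_ext_comp (lin_ext _)).
apply: eq_lin_ext => g /=; rewrite lin_extU linear_sum /=.
by apply: eq_bigr => i _; rewrite linearZ /= lin_extU chain_map_face.
Qed.

Lemma chain_map_cycle (n : nat) (z : bar_cycle R G n) :
  chain_map z \in @is_cycle R H n.
Proof.
have /eqP dz : bar_d z == 0 by exact: cycleP z.
by rewrite inE chain_map_d dz raddf0.
Qed.

Definition cycle_map (n : nat) (z : bar_cycle R G n) : bar_cycle R H n :=
  BarCycle (chain_map_cycle z).

Definition homology_map (n : nat) (a : homology R G n) : homology R H n :=
  homology_class (cycle_map (homology_repr a)).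

Lemma homology_map_class (n : nat) (z : bar_cycle R G n) :
  homology_map (homology_class z) = homology_class (cycle_map z).
Proof.
apply/homology_class_eq; rewrite !inE.
have : homology_repr (homology_class z) - z \in @cycle_boundary R G n.
  by apply/homology_class_eq; rewrite homology_reprK.
rewrite !inE => -[c dc]; exists (chain_map c).
by rewrite (chain_map_d c) dc raddfB.
Qed.

Lemma homology_map_is_zmod_morphism (n : nat) : zmod_morphism (@homology_map n).
Proof.
move=> a b; rewrite -[a]homology_reprK -[b]homology_reprK -raddfB.
rewrite !homology_map_class -raddfB; congr homology_class.
by apply: val_inj; rewrite /= raddfB.
Qed.

HB.instance Definition _ (n : nat) :=
  GRing.isZmodMorphism.Build (homology R G n) (homology R H n)
    (@homology_map n) (@homology_map_is_zmod_morphism n).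

End HomologyMap.

Arguments homology_map R {G H} f n a.

Definition is_isomorphism (U V : zmodType) (f : {additive U -> V}) : Prop :=
  bijective f.

Section Isoperimetry.
Variables (R : nzRingType) (G : groupType).

Local Open Scope classical_set_scope.

Definition chain_size (n : nat) (c : bar_chain R G n) : nat := #|` msupp c|.

(* The minimum for b in B_n(G), and 0 for the other chains. *)
Definition fill_norm (n : nat) (b : bar_chain R G n) : nat :=
  let sizes := [set chain_size c | c in
                 [set c : bar_chain R G n.+1 | bar_d c = b]] in
  xget 0%N (sizes `&` lbound sizes).

(* isop K is the supremum, in the ordered set of natural numbers, of the filler
   norms of the boundaries of size K; in particular this supremum is finite. *)
Definition isoperimetric_function (n : nat) (isop : nat -> nat) : Prop :=
  forall K : nat,
    supremums [set fill_norm b | b in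
      [set b : bar_chain R G n | b \in @is_boundary R G n /\ chain_size b = K]]
      (isop K).

End Isoperimetry.

(* Main.v *)
Require Import Defs.
From HB Require Import structures.
From mathcomp Require Import all_boot all_order all_algebra finmap.
From mathcomp Require Import boolp classical_sets functions cardinality.
From mathcomp Require Import monalg zify.

(** The points of the group scheme are the solutions of finitely many integral
    equations in finitely many coordinates (finite type, with Hilbert's basis
    theorem), and their products are given by integral polynomials in the
    coordinates (by naturality, read off a universal pair of points).  Hence, for chains with a given number of
    simplices and given coefficients, being a cycle, or having a filling with at
    most M simplices, is a first-order condition on the coordinates of the
    entries.  By quantifier elimination such conditions are quantifier free,
    uniformly in the algebraically closed field; they are therefore preserved
    and reflected by field extensions, and a sentence has the same truth value
    in all algebraically closed fields of characteristic p.

    A shape is a finite list b of coefficients.  Call b finitely covered if, for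
    some M and r, there are r cycles of shape b such that every cycle of shape b
    differs from one of them by a boundary with a filling of size at most M.
    For given M and r this is a sentence, so that it does not depend on the
    field.

    If all shapes are finitely covered, then the cycles of each of the countably
    many shapes represent finitely many classes, and the homology is countable.
    A covering over k remains one over an extension K of k, whence surjectivity
    in homology, while injectivity holds because fillings of a given size
    descend from K to k.  The boundaries among the finitely many covering cycles
    bound the fillings of all boundaries of a given shape, so that the
    isoperimetric function is finite; its values are described by sentences,
    so that it is the same for all fields.

    If some shape b is not finitely covered, let k be uncountable, and suppose
    that k does not inject into the homology.  The coordinates of representatives
    of the classes of cycles of shape b then form a set of parameters which is
    smaller than k.  Finitely many of these classes never account for all cycles
    of shape b with fillings of bounded size.  As k is saturated over small sets
    of parameters, there is a cycle of shape b that avoids all the classes, which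
    is absurd.  So k injects into the homology; conversely the homology, whose
    elements are represented by finite data over k, injects into k. *)

Set Implicit Arguments.
Unset Strict Implicit.
Unset Printing Implicit Defensive.

Import GRing.Theory.

Local Open Scope ring_scope.
Local Open Scope classical_set_scope.

(** * Cardinality of infinite types *)

Definition embeds (A B : Type) : Prop := exists f : A -> B, injective f.

Lemma embeds_trans (A B C : Type) : embeds A B -> embeds B C -> embeds A C.
Proof. by move=> [f fI] [g gI]; exists (g \o f); exact: inj_comp. Qed.

Lemma embeds_prod (A A' B B' : Type) :
  embeds A A' -> embeds B B' -> embeds (A * B) (A' * B').
Proof.
move=> [f fI] [g gI]; exists (fun x => (f x.1, g x.2)).
by move=> [a b] [a' b'] [/fI-> /gI->].
Qed.

Lemma embeds_seq (A B : Type) : embeds A B -> embeds (seq A) (seq B).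
Proof. by move=> [f fI]; exists (map f); exact: inj_map. Qed.

Lemma embeds_count (A : countType) (B : Type) : embeds nat B -> embeds A B.
Proof.
by apply: embeds_trans; exists choice.pickle; exact: pcan_inj choice.pickleK.
Qed.

Lemma sval_inj (A : Type) (P : A -> Prop) : injective (@sval A P).
Proof.
by move=> [x Px] [y Py] /= e; case: _ / e Py => Py; congr exist; exact: Prop_irrelevance.
Qed.

Lemma embeds_card_le (A B : Type) : embeds A B -> ([set: A] #<= [set: B])%card.
Proof.
move=> [f fI]; apply: card_le_trans (card_leT (range f)).
have := @inj_card_eq _ _ [set: A] f (fun x y _ _ => fI x y).
by rewrite card_eq_sym card_eq_le => /andP[].
Qed.

Lemma card_le_embeds (A B : Type) : ([set: A] #<= [set: B])%card -> embeds A B.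
Proof.
move=> /card_leP[g]; pose f (x : A) := val (g (SigSub (mem_set (I : setT x)))).
exists f => x y /val_inj/inj; rewrite !inE => /(_ I I).
by move=> /(congr1 val).
Qed.

(** A maximal partial injection is total on one of its two sides. *)
Lemma embeds_total (A B : Type) : embeds A B \/ embeds B A.
Proof.
pose P (G : set (A * B)) :=
  (forall a b b', G (a, b) -> G (a, b') -> b = b') /\
  (forall a a' b, G (a, b) -> G (a', b) -> a = a').
have [|G [[Gf Gi] Gmax]] := @Zorn_bigcup (A * B)%type P.
  move=> F FP Ftot; split=> [a b b'|a a' b] [X FX Xab] [Y FY Yab].
    by have [XY|YX] := Ftot _ _ FX FY;
      [apply: (FP _ FY).1 (XY _ Xab) Yab | apply: (FP _ FX).1 Xab (YX _ Yab)].
  by have [XY|YX] := Ftot _ _ FX FY;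
    [apply: (FP _ FY).2 (XY _ Xab) Yab | apply: (FP _ FX).2 Xab (YX _ Yab)].
have [Atot|/existsNP[a aN]] := pselect (forall a, exists b, G (a, b)).
  left; have [f fG] := choice Atot; exists f => a a' e.
  by apply: Gi (fG a) _; rewrite e.
right; have [Btot|/existsNP[b bN]] := pselect (forall b, exists a, G (a, b)).
  have [f fG] := choice Btot; exists f => b b' e.
  by apply: Gf (fG b) _; rewrite e.
exfalso; apply: (Gmax (G `|` [set (a, b)])).
  split=> [|sub]; first by move=> ? ?; left.
  by apply: aN; exists b; apply: sub; right.
split=> [x y y'|x x' y] [Gx|[-> ->]] [Gx'|].
- exact: Gf Gx Gx'.
- by case=> exa _; case: aN; exists y; rewrite -exa.
- by case: aN; exists y'.
- by case.
- exact: Gi Gx Gx'.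
- by case=> _ eyb; case: bN; exists x; rewrite -eyb.
- by case: bN; exists x'.
- by case=> ->.
Qed.

Section Square.
Variables (X : Type) (nX : embeds nat X).

(** Below, an injection D * D -> D, for a subset D of X, is given by its graph
    G, from which dom recovers D through the diagonal. *)
Let dom (G : set (X * X * X)) (a : X) : Prop := exists z, G (a, a, z).

Let pairing (G : set (X * X * X)) : Prop :=
  [/\ forall p z z', G (p, z) -> G (p, z') -> z = z',
      forall p q z, G (p, z) -> G (q, z) -> p = q,
      forall a b, dom G a -> dom G b -> exists z, G (a, b, z)
    & forall a b z, G (a, b, z) -> [/\ dom G a, dom G b & dom G z]].

Let big (G : set (X * X * X)) : Prop :=
  exists2 f : nat -> X, injective f & forall n, dom G (f n).

Let pairing_of (D : set X) (f : X * X -> X) :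
  (forall p q, D p.1 -> D p.2 -> D q.1 -> D q.2 -> f p = f q -> p = q) ->
  (forall a b, D a -> D b -> D (f (a, b))) ->
  let G := [set x | [/\ D x.1.1, D x.1.2 & x.2 = f x.1]] in
  dom G = D /\ pairing G.
Proof.
move=> fI fD G; have domG : dom G = D.
  apply/seteqP; split=> [a [z []]//|a Da].
  by exists (f (a, a)).
split=> //; split=> [p z z' [_ _ /=->] [_ _ /=->]//|||].
- by move=> p q z [/= p1 p2 ->] [/= q1 q2] /fI; exact.
- by rewrite domG => a b Da Db; exists (f (a, b)).
- by rewrite domG => a b z [/= Da Db ->]; split=> //; exact: fD.
Qed.

Let pairing_maximal : exists G, [/\ pairing G, big G
  & forall G', pairing G' -> G `<=` G' -> G' `<=` G].
Proof.
pose P G := pairing G /\ (G !=set0 -> big G).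
have [|G [[Gp Gb] Gmax]] := @Zorn_bigcup (X * X * X)%type P.
  move=> F FP Ftot.
  have common Y Z : F Y -> F Z -> exists2 W, F W & Y `<=` W /\ Z `<=` W.
    move=> FY FZ; have [YZ|ZY] := Ftot _ _ FY FZ; [exists Z|exists Y] => //.
      by split=> // x.
    by split=> // x.
  have domU Y : F Y -> dom Y `<=` dom (\bigcup_(G in F) G).
    by move=> FY a [z Yz]; exists z; exists Y.
  split; last first.
    move=> [x [Y FY Yx]]; have [|f fI fY] := (FP _ FY).2; first by exists x.
    by exists f => // n; exact: domU (fY n).
  split=> [p z z' [Y FY Yz] [Z FZ Zz]|p q z [Y FY Yz] [Z FZ Zz]||].
  - have [W FW [YW ZW]] := common _ _ FY FZ.
    have [[Wf _ _ _] _] := FP _ FW. exact: Wf (YW _ Yz) (ZW _ Zz).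
  - have [W FW [YW ZW]] := common _ _ FY FZ.
    have [[_ Wi _ _] _] := FP _ FW. exact: Wi (YW _ Yz) (ZW _ Zz).
  - move=> a b [za [Y FY Ya]] [zb [Z FZ Zb]].
    have [W FW [YW ZW]] := common _ _ FY FZ.
    have [[_ _ Wt _] _] := FP _ FW.
    have [||z Wz] := Wt a b; [by exists za; exact: YW|by exists zb; exact: ZW|].
    by exists z; exists W.
  - move=> a b z [Y FY Yz]; have [[_ _ _ Yd] _] := FP _ FY.
    by have [? ? ?] := Yd _ _ _ Yz; split; apply: (domU _ FY).
have [f fI] := nX.
have [h hK] : exists h : X -> nat, cancel f h.
  have [x|h hP] := @boolp.choice _ _ (fun x n => forall m, f m = x -> m = n).
    have [[n _ <-]|xN] := pselect (range f x); first by exists n => m /fI.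
    by exists 0%N => m fm; case: xN; exists m.
  by exists h => n; exact/esym/hP.
pose g p := f (choice.pickle (h p.1, h p.2)).
have [| |domG0 G0p] := @pairing_of (range f) g.
- move=> [a b] [a' b'] /= [n _ <-] [m _ <-] [n' _ <-] [m' _ <-].
  by rewrite /g /= !hK => /fI/(pcan_inj choice.pickleK)[-> ->].
- by move=> a b _ _; exists (choice.pickle (h a, h b)).
have Gb' : big G.
  apply: Gb; have [//|Gn0] := pselect (G !=set0); exfalso.
  apply: (Gmax _ _ (conj G0p _)); last by exists f => // n; rewrite domG0; exists n.
  split=> [x Gx|sub]; first by case: Gn0; exists x.
  apply: Gn0; exists (f 0%N, f 0%N, g (f 0%N, f 0%N)); apply: sub => /=.
  by split; [exists 0%N | exists 0%N |].
exists G; split=> // G' G'p GG'; have [//|G'G] := pselect (G' `<=` G).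
exfalso; apply: (Gmax G'); [by split|split=> // _].
have [f' f'I f'D] := Gb'; exists f' => // n.
by have [z /GG' Gz] := f'D n; exists z.
Qed.

(** A maximal pairing has a domain D that does not inject into its complement:
    otherwise the new pairs of elements of the union of D and a disjoint copy of
    D could be coded in that copy.  So the complement injects into D, and X
    injects into two copies of D (Hessenberg). *)
Lemma embeds_square : embeds (X * X) X.
Proof.
have [G [[Gf Gi Gt Gd] [i iI iD] Gmax]] := pairing_maximal.
have [f fG] : exists f : X * X -> X,
    forall a b, dom G a -> dom G b -> G (a, b, f (a, b)).
  have [f fG] : exists f : X * X -> X, forall p,
      dom G p.1 -> dom G p.2 -> G (p, f p).
    pose R (p : X * X) z := dom G p.1 -> dom G p.2 -> G (p, z).
    suff /boolp.choice[f fP] : forall p, exists z, R p z by exists f.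
    move=> [a b]; rewrite /R /=; have [[Da Db]|N] := pselect (dom G a /\ dom G b).
      by have [z Gz] := Gt _ _ Da Db; exists z.
    by exists a => Da Db; case: N.
  by exists f => a b; exact: (fG (a, b)).
have fI a b a' b' : dom G a -> dom G b -> dom G a' -> dom G b' ->
    f (a, b) = f (a', b') -> a = a' /\ b = b'.
  move=> Da Db Da' Db' e; have := fG _ _ Da' Db'; rewrite -e => G'.
  by have [-> ->] := Gi _ _ _ (fG _ _ Da Db) G'.
have fD a b : dom G a -> dom G b -> dom G (f (a, b)).
  by move=> Da Db; have [] := Gd _ _ _ (fG _ _ Da Db).
have [[j jI]|[j jI]] := embeds_total {x | ~ dom G x} {x | dom G x}.
  have [h [hD hI]] : exists h : X -> X, (forall x, dom G (h x)) /\ injective h.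
    pose h x := match pselect (dom G x) with
      | left _ => f (x, i 0%N)
      | right Nx => f (sval (j (exist _ x Nx)), i 1%N) end.
    exists h; split=> [x|x y]; rewrite /h.
      by case: pselect => [Dx|Nx]; apply: (fD) => //; exact: (svalP (j _)).
    case: pselect => Dx; case: pselect => Dy e.
    - by have [] := fI _ _ _ _ _ _ _ _ e.
    - have [||||_ /iI//] := fI _ _ _ _ _ _ _ _ e => //; exact: (svalP (j _)).
    - have [||||_ /iI//] := fI _ _ _ _ _ _ _ _ e => //; exact: (svalP (j _)).
    - have [||||e' _] := fI _ _ _ _ _ _ _ _ e => //; try exact: (svalP (j _)).
      by have /jI[] : j (exist _ x Dx) = j (exist _ y Dy) by exact: sval_inj.
  exists (fun p => f (h p.1, h p.2)) => -[a b] [a' b'] /= e.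
  by have [||||/hI-> /hI->] := fI _ _ _ _ _ _ _ _ e.
pose D' : set X := [set x | exists d, x = sval (j d)].
(* An element of D or D' is coded by an element of D and a tag. *)
have [c cP] : exists c : X -> X * nat, forall x, dom G x \/ D' x ->
    dom G (c x).1 /\ (forall y, dom G y \/ D' y -> c x = c y -> x = y).
  have [c cP] : exists c : X -> X * nat, forall x,
      (dom G x -> c x = (x, 0%N)) /\ (forall d, x = sval (j d) -> c x = (sval d, 1%N)).
    pose R x cx := (dom G x -> cx = (x, 0%N)) /\
      (forall d, x = sval (j d) -> cx = (sval d, 1%N)).
    suff /boolp.choice[c cP] : forall x, exists cx, R x cx by exists c.
    move=> x; rewrite /R.
    have [Dx|Nx] := pselect (dom G x).
      exists (x, 0%N); split=> // d xd; case: (svalP (j d)); rewrite -xd.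
      exact: Dx.
    have [[d xd]|N'] := pselect (D' x).
      exists (sval d, 1%N); split=> // d' xd'.
      suff -> : d = d' by [].
      by apply/jI/sval_inj; rewrite -xd.
    by exists (x, 0%N); split=> // d xd; case: N'; exists d.
  have cE x y : dom G x \/ D' x -> dom G y \/ D' y -> c x = c y -> x = y.
    move=> [Dx|[d xd]] [Dy|[d' yd]].
    - by rewrite (cP x).1 // (cP y).1 // => -[].
    - by rewrite (cP x).1 // ((cP y).2 _ yd) => -[].
    - by rewrite ((cP x).2 _ xd) (cP y).1 // => -[].
    - rewrite ((cP x).2 _ xd) ((cP y).2 _ yd) => -[e]; rewrite xd yd.
      by congr (sval (j _)); exact: sval_inj.
  exists c => x xD; split=> [|y yD]; last exact: cE.
  case: (xD) => [Dx|[d xd]]; first by rewrite (cP x).1.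
  by rewrite ((cP x).2 _ xd); exact: (svalP d).
pose code p : X := f (f ((c p.1).1, i (c p.1).2), f ((c p.2).1, i (c p.2).2)).
have codeD p : dom G p.1 \/ D' p.1 -> dom G p.2 \/ D' p.2 -> dom G (code p).
  by move=> /cP[p1 _] /cP[p2 _]; apply: (fD); apply: (fD) => //; exact: iD.
have codeI p q : dom G p.1 \/ D' p.1 -> dom G p.2 \/ D' p.2 ->
    dom G q.1 \/ D' q.1 -> dom G q.2 \/ D' q.2 -> code p = code q -> p = q.
  move=> p1 p2 q1 q2.
  have [c1 _] := cP _ p1; have [c2 _] := cP _ p2.
  have [c3 _] := cP _ q1; have [c4 _] := cP _ q2.
  move=> /fI[]; try by apply: (fD) => //; exact: iD.
  move=> /fI[]//; try exact: iD.
  move=> e1 /iI e2 /fI[]//; try exact: iD.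
  move=> e3 /iI e4.
  case: p q p1 p2 q1 q2 {c1 c2 c3 c4} e1 e2 e3 e4 => [a b] [a' b'] /= p1 p2 q1 q2.
  move=> e1 e2 e3 e4.
  have [_ /(_ a' q1)->] := cP _ p1; last first.
    by rewrite [LHS]surjective_pairing e1 e2 -surjective_pairing.
  have [_ /(_ b' q2)->//] := cP _ p2.
  by rewrite [LHS]surjective_pairing e3 e4 -surjective_pairing.
(* The last branch is not taken on pairs of elements of D or D'. *)
pose g p : X := match pselect (dom G p.1 /\ dom G p.2) with
  | left _ => f p
  | right _ => if pselect (dom G (code p)) is left Dp
               then sval (j (exist _ _ Dp)) else i 0%N end.
pose D2 := dom G `|` D'.
have gin p : dom G p.1 /\ dom G p.2 -> g p = f p.
  by rewrite /g; case: pselect.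
have gout p : D2 p.1 -> D2 p.2 -> ~ (dom G p.1 /\ dom G p.2) ->
    exists d, sval d = code p /\ g p = sval (j d).
  move=> p1 p2 Np; rewrite /g; case: pselect => // _.
  case: pselect => [Dp|[]]; last exact: codeD.
  by exists (exist _ _ Dp).
have fin p : dom G p.1 /\ dom G p.2 -> dom G (f p).
  by case: p => a b [? ?]; exact: fD.
have [| |domG2 G2p] := @pairing_of D2 g.
- move=> p q p1 p2 q1 q2.
  have [Dp|Np] := pselect (dom G p.1 /\ dom G p.2);
    have [Dq|Nq] := pselect (dom G q.1 /\ dom G q.2).
  + rewrite (gin _ Dp) (gin _ Dq).
    case: p q Dp Dq {p1 p2 q1 q2} => [a b] [a' b'] [Da Db] [Da' Db'].
    by move=> /fI[]// -> ->.
  + have [d [_ ->]] := gout _ q1 q2 Nq; rewrite (gin _ Dp) => e.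
    by case: (svalP (j d)); rewrite -e; exact: fin.
  + have [d [_ ->]] := gout _ p1 p2 Np; rewrite (gin _ Dq) => e.
    by case: (svalP (j d)); rewrite e; exact: fin.
  + have [d [ed ->]] := gout _ p1 p2 Np; have [d' [ed' ->]] := gout _ q1 q2 Nq.
    by move=> /sval_inj/jI dd'; apply: codeI => //; rewrite -ed -ed' dd'.
- move=> a b Da Db; have [Dab|Nab] := pselect (dom G a /\ dom G b).
    by rewrite (gin (a, b)) //; left; exact: fin.
  by have [d [_ ->]] := gout (a, b) Da Db Nab; right; exists d.
case: (svalP (j (exist _ _ (iD 0%N)))); set x := sval _.
have Dx : D2 x by right; exists (exist _ _ (iD 0%N)).
have : dom [set x | [/\ D2 x.1.1, D2 x.1.2 & x.2 = g x.1]] x by rewrite domG2.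
move=> [z G2z]; exists z; apply: Gmax G2z => //.
move=> [[a b] z'] Gz'; have [Da Db _] := Gd _ _ _ Gz'.
split; [by left|by left|rewrite gin //=].
exact: Gf Gz' (fG _ _ Da Db).
Qed.

End Square.

Lemma embeds_seq_self (X : Type) : embeds nat X -> embeds (seq X) X.
Proof.
move=> nX; have [f fI] := embeds_square nX; have [i iI] := nX.
have [g gI] : exists g : seq X -> X, forall s t, size s = size t ->
    g s = g t -> s = t.
  exists (foldr (fun x y => f (x, y)) (i 0%N)).
  elim=> [|x s IHs] [|y t] //= [st] /fI[-> e]; by rewrite (IHs t).
exists (fun s => f (i (size s), g s)) => s t /fI[/iI]; exact: gI.
Qed.

Lemma embeds_sum_self (X : Type) : embeds nat X -> embeds (X + X) X.
Proof.
move=> nX; have [f fI] := embeds_square nX; have [i iI] := nX.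
exists (fun z => match z with inl x => f (i 0%N, x) | inr x => f (i 1%N, x) end).
by case=> x [] y /fI[] => [-> //|/iI//|/iI//|->].
Qed.

(** * Integer polynomials as terms *)

Inductive pterm (T : Type) : Type :=
  | PVar of T
  | POne
  | POpp of pterm T
  | PAdd of pterm T & pterm T
  | PMul of pterm T & pterm T.

Arguments POne {T}.

Section PtermCountable.
Variable T : countType.

Fixpoint pterm_tree (t : pterm T) : GenTree.tree T :=
  match t with
  | PVar x => GenTree.Leaf x
  | POne => GenTree.Node 0 [::]
  | POpp t => GenTree.Node 1 [:: pterm_tree t]
  | PAdd t u => GenTree.Node 2 [:: pterm_tree t; pterm_tree u]
  | PMul t u => GenTree.Node 3 [:: pterm_tree t; pterm_tree u]
  end.

Fixpoint tree_pterm (g : GenTree.tree T) : option (pterm T) :=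
  match g with
  | GenTree.Leaf x => Some (PVar x)
  | GenTree.Node 0 _ => Some POne
  | GenTree.Node 1 [:: g] => omap (@POpp T) (tree_pterm g)
  | GenTree.Node 2 [:: g; h] =>
      obind (fun t => omap (PAdd t) (tree_pterm h)) (tree_pterm g)
  | GenTree.Node _ [:: g; h] =>
      obind (fun t => omap (PMul t) (tree_pterm h)) (tree_pterm g)
  | _ => None
  end.

Lemma pterm_treeK : pcancel pterm_tree tree_pterm.
Proof. by elim=> //= [t ->|t -> u ->|t -> u ->]. Qed.

HB.instance Definition _ := Countable.copy (pterm T) (pcan_type pterm_treeK).

End PtermCountable.

Section Peval.
Variables (T : Type) (R : comPzRingType).

Fixpoint peval (e : T -> R) (t : pterm T) : R :=
  match t with
  | PVar x => e x
  | POne => 1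
  | POpp t => - peval e t
  | PAdd t u => peval e t + peval e u
  | PMul t u => peval e t * peval e u
  end.

End Peval.

Lemma peval_morph (T : Type) (R S : comPzRingType) (f : {rmorphism R -> S})
  (e : T -> R) (t : pterm T) : f (peval e t) = peval (fun x => f (e x)) t.
Proof.
elim: t => [x||t IH|t IHt u IHu|t IHt u IHu] //=.
- by rewrite rmorph1.
- by rewrite rmorphN IH.
- by rewrite rmorphD IHt IHu.
- by rewrite rmorphM IHt IHu.
Qed.

Lemma eq_peval (T : Type) (R : comPzRingType) (e e' : T -> R) :
  e =1 e' -> peval e =1 peval e'.
Proof. by move=> /funext->. Qed.

Fixpoint psubst (T U : Type) (s : T -> pterm U) (t : pterm T) : pterm U :=
  match t with
  | PVar x => s x
  | POne => POne
  | POpp t => POpp (psubst s t)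
  | PAdd t u => PAdd (psubst s t) (psubst s u)
  | PMul t u => PMul (psubst s t) (psubst s u)
  end.

Lemma peval_subst (T U : Type) (R : comPzRingType) (e : U -> R)
    (s : T -> pterm U) (t : pterm T) :
  peval e (psubst s t) = peval (fun x => peval e (s x)) t.
Proof.
by elim: t => [x||t IH|t IHt u IHu|t IHt u IHu] //=; rewrite ?IH ?IHt ?IHu.
Qed.

Definition PZero {T : Type} : pterm T := PAdd POne (POpp POne).

Lemma peval0 (T : Type) (R : comPzRingType) (e : T -> R) : peval e PZero = 0.
Proof. exact: addrN. Qed.

Definition psum (T I : Type) (r : seq I) (F : I -> pterm T) : pterm T :=
  foldr (fun i => PAdd (F i)) PZero r.

Lemma peval_sum (T I : Type) (R : comPzRingType) (e : T -> R) (r : seq I)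
  (F : I -> pterm T) : peval e (psum r F) = \sum_(i <- r) peval e (F i).
Proof.
elim: r => [|i r IHr] /=; first by rewrite big_nil addrN.
by rewrite big_cons IHr.
Qed.

Definition pprod (T I : Type) (r : seq I) (F : I -> pterm T) : pterm T :=
  foldr (fun i => PMul (F i)) POne r.

Lemma peval_prod (T I : Type) (R : comPzRingType) (e : T -> R) (r : seq I)
  (F : I -> pterm T) : peval e (pprod r F) = \prod_(i <- r) peval e (F i).
Proof.
elim: r => [|i r IHr] /=; first by rewrite big_nil.
by rewrite big_cons IHr.
Qed.

(** * Uniformly definable predicates over algebraically closed fields *)

Notation fpred T := (forall k : closedFieldType, (T -> k) -> Prop).

(** Definable without quantifiers, over the integers and uniformly in the
    field: a Boolean combination of the equations t = 0, for t in a finite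
    family, is the same as a predicate which is determined by the set of those
    t that vanish.  This form makes all Boolean combinations immediate. *)
Definition udef (T : Type) (D : fpred T) : Prop :=
  exists (A : finType) (L : A -> pterm T),
    forall (k K : closedFieldType) (e : T -> k) (e' : T -> K),
      (forall a, peval e (L a) = 0 <-> peval e' (L a) = 0) ->
      D k e <-> D K e'.

Section Udef.
Variable T : Type.
Implicit Types (D : fpred T) (t : pterm T).

Lemma udef_ext D D' : (forall k e, D k e <-> D' k e) -> udef D -> udef D'.
Proof.
by move=> DD' [A [L LP]]; exists A, L => k K e e' ee'; rewrite -!DD'; exact: LP.
Qed.

Lemma udef_eq0 t : udef (fun k e => peval e t = 0).
Proof. by exists unit, (fun=> t) => k K e e' /(_ tt). Qed.

Lemma udef_dep (A : finType) (P : A -> fpred T) D :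
  (forall a, udef (P a)) ->
  (forall (k K : closedFieldType) (e : T -> k) (e' : T -> K),
     (forall a, P a k e <-> P a K e') -> D k e <-> D K e') ->
  udef D.
Proof.
move=> PU PD; have [B BP] := boolp.choice PU.
pose L a := sval (cid (BP a)).
have LP a := svalP (cid (BP a)).
exists {a : A & B a}, (fun x => L (tag x) (tagged x)) => k K e e' ee'.
by apply: PD => a; apply: LP => b; exact: (ee' (Tagged B b)).
Qed.

Lemma udef_not D : udef D -> udef (fun k e => ~ D k e).
Proof.
move=> DU; apply: (@udef_dep unit (fun=> D)) => // k K e e' /(_ tt).
by move=> DD; split=> nD ?; apply/nD/DD.
Qed.

Lemma udef_forall (A : finType) (P : A -> fpred T) :
  (forall a, udef (P a)) -> udef (fun k e => forall a, P a k e).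
Proof.
move=> PU; apply: (udef_dep PU) => k K e e' PP.
by split=> H a; apply/PP.
Qed.

Lemma udef_and D D' :
  udef D -> udef D' -> udef (fun k e => D k e /\ D' k e).
Proof.
move=> DU D'U; apply: (@udef_dep bool (fun b => if b then D else D')).
  by case.
move=> k K e e' DD; have := DD true; have := DD false => /= ? ?; tauto.
Qed.

Lemma udef_or D D' :
  udef D -> udef D' -> udef (fun k e => D k e \/ D' k e).
Proof.
move=> DU D'U; apply: (@udef_dep bool (fun b => if b then D else D')).
  by case.
move=> k K e e' DD; have := DD true; have := DD false => /= ? ?; tauto.
Qed.

Lemma udef_cst (P : Prop) : udef (fun k (e : T -> k) => P).
Proof. by exists void, (fun x : void => match x with end). Qed.

End Udef.

Lemma udef_subst (T U : Type) (s : T -> pterm U) (D : fpred T) :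
  udef D -> udef (fun k e => D k (fun x => peval e (s x))).
Proof.
move=> [A [L LP]]; exists A, (psubst s \o L) => k K e e' ee'.
by apply: LP => a; have := ee' a; rewrite !peval_subst.
Qed.

Lemma udef_transfer (T : Type) (D : fpred T) (k K : closedFieldType)
    (f : {rmorphism k -> K}) (e : T -> k) :
  udef D -> D k e <-> D K (fun x => f (e x)).
Proof.
move=> [A [L LP]]; apply: LP => a; rewrite -peval_morph.
by split=> [->|/eqP]; rewrite ?rmorph0 // fmorph_eq0 => /eqP.
Qed.

Lemma has_char_natr (k K : closedFieldType) (p n : nat) :
  has_char k p -> has_char K p -> (n%:R == 0 :> k) = (n%:R == 0 :> K).
Proof.
rewrite /has_char; case: eqP => [_ /pcharf0P-> /pcharf0P->//|_ kp Kp].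
by rewrite -(dvdn_pcharf kp) -(dvdn_pcharf Kp).
Qed.

Lemma peval_int (T : Type) (R : comPzRingType) (t : pterm T) :
  peval (fun=> 0 : R) t = (peval (fun=> 0 : int) t)%:~R.
Proof.
by elim: t => [x||t IH|t IHt u IHu|t IHt u IHu] //=;
  rewrite ?intrN ?intrD ?intrM ?IH ?IHt ?IHu.
Qed.

(** At the zero environment all terms take integral values, and the
    characteristic decides which integers vanish.  A predicate that does not
    depend on its environment thus transfers between fields none of which
    embeds in the other. *)
Lemma udef_sentence (T : Type) (D : fpred T) (k K : closedFieldType) (p : nat) :
  has_char k p -> has_char K p -> udef D -> D k (fun=> 0) <-> D K (fun=> 0).
Proof.
move=> kp Kp [A [L LP]]; apply: LP => a.
rewrite (@peval_int T k) (@peval_int T K).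
have H n : n%:R = 0 :> k <-> n%:R = 0 :> K.
  have e := has_char_natr n kp Kp.
  by split=> /eqP; [rewrite e|rewrite -e] => /eqP.
case: (peval _ _) => n; first by rewrite -!pmulrn.
rewrite NegzE !mulrNz -!pmulrn.
by split=> /eqP; rewrite oppr_eq0 => /eqP/H->; rewrite oppr0.
Qed.

(** * Elimination of one quantifier *)

(** The coefficients are listed in increasing order; the last one may vanish,
    so that the length of the list is only a bound on the size. *)
Definition pol (T : Type) (k : comNzRingType) (e : T -> k) (s : seq (pterm T)) :
  {poly k} := Poly (map (peval e) s).

Arguments pol : simpl never.

Section Fpoly.
Variable T : eqType.

Notation pfun := (forall k : closedFieldType, (T -> k) -> {poly k}).

Definition fpoly (N : nat) (p : pfun) : Prop :=
  exists Q : nat -> pterm T, forall (k : closedFieldType) (e : T -> k),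
    (forall i, (p k e)`_i = peval e (Q i)) /\ (size (p k e) <= N)%N.

Lemma fpolyP N p : fpoly N p ->
  exists2 s, size s = N & forall k e, p k e = pol e s.
Proof.
move=> [Q QP]; exists (mkseq Q N) => [|k e]; first by rewrite size_mkseq.
have [pQ pN] := QP k e; apply/polyP => i; rewrite coef_Poly.
have [iN|Ni] := ltnP i N.
  by rewrite (nth_map PZero) ?size_mkseq // nth_mkseq // pQ.
rewrite [RHS]nth_default ?size_map ?size_iota //.
by rewrite nth_default // (leq_trans pN).
Qed.

Lemma fpoly_pol s : fpoly (size s) (fun k e => pol e s).
Proof.
exists (nth PZero s) => k e; split=> [i|]; last first.
  by rewrite (leq_trans (size_Poly _)) // size_map.
rewrite coef_Poly; have [iN|Ni] := ltnP i (size s).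
  by rewrite (nth_map PZero).
by rewrite !nth_default ?size_map ?peval0.
Qed.

Lemma fpolyW N M p : (N <= M)%N -> fpoly N p -> fpoly M p.
Proof.
move=> NM [Q QP]; exists Q => k e; have [pQ pN] := QP k e; split=> //.
exact: leq_trans NM.
Qed.

Lemma fpolyC t : fpoly 1 (fun k e => (peval e t)%:P).
Proof.
exists (fun i => if i == 0%N then t else PZero) => k e.
by split=> [i|]; [rewrite coefC; case: eqP; rewrite ?peval0|exact: size_polyC_leq1].
Qed.

Lemma fpolyXn n : fpoly n.+1 (fun k e => 'X^n).
Proof.
exists (fun i => if i == n then POne else PZero) => k e.
by split=> [i|]; [rewrite coefXn; case: eqP; rewrite /= ?addrN|rewrite size_polyXn].
Qed.

Lemma fpolyN N p : fpoly N p -> fpoly N (fun k e => - p k e).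
Proof.
move=> [Q QP]; exists (fun i => POpp (Q i)) => k e; have [pQ pN] := QP k e.
by split=> [i|]; rewrite ?coefN ?size_polyN //= pQ.
Qed.

Lemma fpolyD N M p q : fpoly N p -> fpoly M q ->
  fpoly (maxn N M) (fun k e => p k e + q k e).
Proof.
move=> [P PP] [Q QP]; exists (fun i => PAdd (P i) (Q i)) => k e.
have [pP pN] := PP k e; have [qQ qM] := QP k e.
split=> [i|]; first by rewrite coefD pP qQ.
rewrite (leq_trans (size_polyD _ _)) // geq_max !leq_max pN qM.
by rewrite orbT.
Qed.

Lemma fpolyM N M p q : fpoly N p -> fpoly M q ->
  fpoly (N + M) (fun k e => p k e * q k e).
Proof.
move=> [P PP] [Q QP].
exists (fun i => psum (iota 0 i.+1) (fun j => PMul (P j) (Q (i - j)%N))) => k e.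
have [pP pN] := PP k e; have [qQ qM] := QP k e.
split=> [i|].
  rewrite coefM peval_sum -(big_mkord xpredT (fun j => (p k e)`_j * (q k e)`_(i - j))).
  by rewrite /index_iota subn0; apply: eq_bigr => j _; rewrite pP qQ.
rewrite (leq_trans (size_polyMleq _ _)) // (leq_trans (leq_pred _)) //.
exact: leq_add.
Qed.

Lemma fpoly_exp N p n : fpoly N p -> exists M, fpoly M (fun k e => p k e ^+ n).
Proof.
move=> pN; elim: n => [|n [M IH]]; first by exists 1%N; exact: (fpolyXn 0).
exists (N + M)%N; have [Q QP] := fpolyM pN IH; exists Q => k e.
by rewrite exprS; exact: QP.
Qed.

(** One step of pseudo-division: the two terms of degree N cancel, whether or
    not the formal leading coefficients vanish. *)
Lemma fpoly_reduce d N p q : fpoly d.+1 p -> (d <= N)%N -> fpoly N.+1 q ->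
  fpoly N (fun k e =>
    ((p k e)`_d)%:P * q k e - (((q k e)`_N)%:P * 'X^(N - d)) * p k e).
Proof.
move=> pd dN qN; have [P PP] := pd; have [Q QP] := qN.
have [R RP] := fpolyD (fpolyM (fpolyC (P d)) qN)
  (fpolyN (fpolyM (fpolyM (fpolyC (Q N)) (fpolyXn (N - d))) pd)).
exists R => k e; have [pP pS] := PP k e; have [qQ qS] := QP k e.
rewrite pP qQ; have [cR _] := RP k e; split=> //.
apply/leq_sizeP => i Ni; rewrite coefB coefCM -mulrA coefCM coefXnM.
have -> : (i < N - d)%N = false.
  by apply/negbTE; rewrite -leqNgt (leq_trans _ Ni) // leq_subr.
move: Ni; rewrite leq_eqVlt => /predU1P[<-|Ni].
  by rewrite subKn // pP qQ mulrC subrr.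
rewrite [(q k e)`_i]nth_default ?(leq_trans qS) // mulr0 sub0r.
rewrite nth_default ?mulr0 ?oppr0 // (leq_trans pS) //.
by rewrite ltn_subRL subnK.
Qed.

(** Where the coefficient of p in degree d does not vanish, the steps of a
    pseudo-division preserve divisibility by p, until the remainder is too short
    to be divisible by p unless it is zero. *)
Lemma udef_dvdp d N p q : fpoly d.+1 p -> fpoly N q ->
  udef (fun k e => (p k e)`_d <> 0 /\ p k e %| q k e).
Proof.
move=> pd; have [P PP] := pd.
have pc : udef (fun k e => (p k e)`_d <> 0).
  apply/udef_not/(udef_ext _ (udef_eq0 (P d))) => k e.
  by rewrite (PP k e).1.
elim: N => [|N IHN] in q *.
  move=> [Q qN]; apply: udef_ext pc => k e.
  have [_] := qN k e; rewrite leqn0 size_poly_eq0 => /eqP->.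
  by rewrite dvdp0; split=> [?|[]].
move=> qN; have [dN|Nd] := leqP d N.
  apply: udef_ext (IHN _ (fpoly_reduce pd dN qN)) => k e.
  set u := ((q k e)`_N)%:P * _; have pu : p k e %| u * p k e by exact: dvdp_mull.
  by split=> -[c0]; rewrite dvdp_subl // mul_polyC dvdpZr //; exact/eqP.
have [Q QP] := qN; apply: (udef_ext (D := fun k e =>
  (p k e)`_d <> 0 /\ forall i : 'I_N.+1, peval e (Q i) = 0)) => [k e|]; last first.
  by apply: udef_and => //; apply: udef_forall => i; exact: udef_eq0.
have [pP pS] := PP k e; have [qQ qS] := QP k e.
split=> -[c0 H]; split=> //.
  suff -> : q k e = 0 by exact: dvdp0.
  apply/polyP => i; rewrite coef0; have [iN|Ni] := ltnP i N.+1.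
    by rewrite qQ; exact: (H (Ordinal iN)).
  by rewrite nth_default // (leq_trans qS).
have q0 : q k e = 0.
  apply/eqP/negPn/negP => q0; have := dvdp_leq q0 H; rewrite leqNgt => /negP; case.
  apply: leq_ltn_trans qS _; apply: leq_ltn_trans Nd _; rewrite ltnNge.
  by apply/negP => /leq_sizeP/(_ d (leqnn d)).
by move=> i; rewrite -qQ q0 coef0.
Qed.

(** Over an algebraically closed field f has at most n linear factors, each of
    which divides g if the roots of f are roots of g. *)
Lemma closed_dvdp_exp (k : closedFieldType) (f g : {poly k}) (n : nat) :
  f != 0 -> (size f <= n)%N ->
  (f %| g ^+ n) <-> (forall y, root f y -> root g y).
Proof.
move=> f0 fn; split=> [fg y fy|fg].
  have := dvdp_trans (_ : 'X - y%:P %| f) fg; rewrite !dvdp_XsubCl => /(_ fy).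
  by rewrite /root horner_exp expf_eq0 => /andP[].
have [r fE] := closed_field_poly_normal f.
have rn : (size r <= n)%N.
  rewrite (leq_trans _ fn) // fE size_scale ?lead_coef_eq0 //.
  by rewrite size_prod_XsubC leqnSn.
have rg y : y \in r -> 'X - y%:P %| g.
  move=> yr; rewrite dvdp_XsubCl fg // fE rootE hornerZ horner_prod.
  by rewrite (big_rem y) //= hornerXsubC subrr mul0r mulr0.
apply: dvdp_trans (dvdp_exp2l g rn); rewrite fE dvdpZl ?lead_coef_eq0 //.
elim: r rg {fE rn} => [|y r IHr] rg; first by rewrite big_nil dvd1p.
rewrite big_cons exprS dvdp_mul ?rg ?mem_head // IHr // => z zr.
by rewrite rg // inE zr orbT.
Qed.

Let roots (k : closedFieldType) (e : T -> k) (Fs : seq (seq (pterm T))) (y : k) :=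
  all (fun s => root (pol e s) y) Fs.

Let cell Fs (G : seq (pterm T)) : fpred T :=
  fun k e => exists y, roots e Fs y /\ ~~ root (pol e G) y.

Lemma coef_pol_rcons (k : closedFieldType) (e : T -> k) s c :
  (pol e (rcons s c))`_(size s) = peval e c.
Proof. by rewrite coef_Poly map_rcons nth_rcons size_map ltnn eqxx. Qed.

Lemma pol_nil (k : closedFieldType) (e : T -> k) : pol e [::] = 0.
Proof. by apply/polyP => i; rewrite coef_Poly. Qed.

Lemma pol_rcons0 (k : closedFieldType) (e : T -> k) s c :
  peval e c = 0 -> pol e (rcons s c) = pol e s.
Proof.
move=> c0; apply/polyP => i; rewrite !coef_Poly map_rcons nth_rcons c0.
case: ltngtP => // [si|->]; first by rewrite nth_default // ltnW.
by rewrite nth_default.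
Qed.

Lemma udef_case c (D D0 D1 : fpred T) :
  (forall k e, peval e c = 0 -> D k e <-> D0 k e) ->
  (forall k e, peval e c <> 0 -> D k e <-> D1 k e) ->
  udef D0 -> udef (fun k e => peval e c <> 0 /\ D1 k e) -> udef D.
Proof.
move=> DD0 DD1 D0U D1U; apply: (udef_ext _ (udef_or (udef_and (udef_eq0 c) D0U) D1U)).
move=> k e; have [c0|c0] := pselect (peval e c = 0).
  by rewrite (DD0 _ _ c0); split=> [[[]|[]]|?] //; left.
by rewrite (DD1 _ _ c0); split=> [[[]|[]]|?] //; right.
Qed.

(** Projection of a locally closed set, by the Euclidean algorithm: among two
    polynomials, the longer one is replaced by its remainder by the shorter
    one, unless the formal leading coefficient of the latter vanishes, in which
    case this coefficient is dropped. *)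
Lemma udef_cell Fs G : udef (cell Fs G).
Proof.
(* The successor makes the measure drop when an empty list is removed. *)
have [n] := ubnP (sumn (map (fun s => (size s).+1) Fs)).
elim: n => // n IHn in Fs *; rewrite ltnS.
have nilP Hs : udef (cell Hs G) -> udef (cell ([::] :: Hs) G).
  apply: udef_ext => k e; split=> -[y Hy]; exists y; move: Hy;
    by rewrite /roots /= pol_nil root0.
have dropP F c Hs (k : closedFieldType) (e : T -> k) : peval e c = 0 ->
    cell (rcons F c :: Hs) G e <-> cell (F :: Hs) G e.
  by move=> c0; rewrite /cell /roots /= pol_rcons0.
case: Fs => [|F [|H Fs]] /= Fsn.
- apply: (udef_ext (D := fun k e =>
    ~ forall i : 'I_(size G), peval e (tnth (in_tuple G) i) = 0)) => [k e|]; last first.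
    by apply/udef_not/udef_forall => i; exact: udef_eq0.
  split=> [H|[y [_ Gy]] H].
    suff /closed_nonrootP[y Gy] : pol e G != 0 by exists y.
    apply: contra_notN H => /eqP G0 i; have := congr1 (coefp i) G0.
    rewrite /= coef_Poly coef0 (nth_map POne) ?size_map //.
    by rewrite (tnth_nth POne).
  case/negP: Gy; suff -> : pol e G = 0 by exact: root0.
  apply/polyP => i; rewrite coef_Poly coef0.
  have [iG|Gi] := ltnP i (size G); last by rewrite nth_default // size_map.
  by rewrite (nth_map POne) // -(H (Ordinal iG)) (tnth_nth POne).
- case: (lastP F) => [|F' c] in Fsn *.
    by apply/nilP/IHn; rewrite (leq_trans _ Fsn).
  rewrite addn0 size_rcons in Fsn.
  (* G vanishes at all the roots of F when F divides a high power of G. *)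
  have [M GM] := fpoly_exp (size F').+1 (fpoly_pol G).
  have := fpoly_pol (rcons F' c); rewrite size_rcons => /udef_dvdp /(_ GM) U.
  apply: (@udef_case c _ (cell [:: F'] G) (fun k e =>
      ~ ((pol e (rcons F' c))`_(size F') <> 0 /\
         pol e (rcons F' c) %| pol e G ^+ (size F').+1))).
  + by move=> k e; exact: dropP.
  + move=> k e c0; rewrite coef_pol_rcons closed_dvdp_exp; last 2 first.
    * by apply: contra_not_neq c0 => F0; rewrite -(coef_pol_rcons e F') F0 coef0.
    * by rewrite (leq_trans (size_Poly _)) // size_map size_rcons.
    split=> [[y [/andP[Fy _] Gy]] [_ /(_ y Fy)]|]; first exact/negP.
    move=> N; apply: contrapT => N'; apply: N; split=> // y Fy.
    by apply/negPn/negP => Gy; apply: N'; exists y; rewrite /roots /= Fy.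
  + by apply: IHn; rewrite /= addn0.
  + by apply: udef_and; apply: udef_not => //; exact: udef_eq0.
- wlog FH : F H Fsn / (size F <= size H)%N.
    move=> W; have [FH|/ltnW HF] := leqP (size F) (size H); first exact: W.
    have : udef (cell [:: H, F & Fs] G) by apply: W; rewrite // addnCA.
    by apply: udef_ext => k e; rewrite /cell /roots /=; split=> -[y Hy]; exists y;
      move: Hy; rewrite andbCA.
  case: (lastP F) => [|F' c] in Fsn FH *.
    by apply/nilP/IHn; exact: leq_trans Fsn.
  case sH: (size H) => [|N] in Fsn FH; rewrite size_rcons // in Fsn FH.
  have FU := fpoly_pol (rcons F' c); rewrite size_rcons in FU.
  have HU := fpoly_pol H; rewrite sH in HU.
  have [R RN RP] := fpolyP (fpoly_reduce FU FH HU).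
  apply: (@udef_case c _ (cell (F' :: H :: Fs) G) (cell (rcons F' c :: R :: Fs) G)).
  + by move=> k e; exact: dropP.
  + move=> k e /eqP c0; rewrite /cell /roots /=.
    have FR y : root (pol e (rcons F' c)) y -> root (pol e R) y = root (pol e H) y.
      move=> /rootP Fy; rewrite -RP rootE !hornerE Fy mulr0 subr0 coef_pol_rcons.
      by rewrite mulf_eq0 (negbTE c0).
    by split=> -[y [/and3P[Fy Hy Fsy] Gy]]; exists y;
      rewrite Fy Fsy andbT; split=> //; move: Hy; rewrite FR.
  + by apply: IHn; rewrite /= sH.
  + apply: udef_and; first by apply: udef_not; exact: udef_eq0.
    by apply: IHn; rewrite /= size_rcons RN (leq_trans _ Fsn) // ltn_add2l ltn_add2r.
Qed.

(** * Quantifier elimination *)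

Definition upd (k : Type) (e : T -> k) (x : T) (y : k) : T -> k :=
  fun z => if z == x then y else e z.

Lemma upd_same (k : Type) (e : T -> k) (x : T) (y : k) : upd e x y x = y.
Proof. by rewrite /upd eqxx. Qed.

Lemma upd_other (k : Type) (e : T -> k) (x z : T) (y : k) :
  z != x -> upd e x y z = e z.
Proof. by rewrite /upd => /negbTE->. Qed.

Lemma fpoly_term (x : T) (t : pterm T) : exists s : seq (pterm T),
  forall (k : closedFieldType) (e : T -> k) y,
    (pol e s).[y] = peval (upd e x y) t.
Proof.
suff [N [p pN pE]] : exists N, exists2 p : pfun, fpoly N p
    & forall k e y, (p k e).[y] = peval (upd e x y) t.
  have [s _ ps] := fpolyP pN.
  by exists s => k e y; rewrite -ps pE.
elim: t => [z||t [N [p pN pE]]|t [N [p pN pE]] u [M [q qM qE]]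
    |t [N [p pN pE]] u [M [q qM qE]]] /=.
- exists 2%N; have [zx|zx] := eqVneq z x.
    exists (fun k e => 'X^1); first exact: fpolyXn.
    by move=> k e y; rewrite /upd zx eqxx hornerXn.
  exists (fun k e => (peval e (PVar z))%:P); first exact: fpolyW (fpolyC _).
  by move=> k e y; rewrite /upd (negbTE zx) hornerC.
- exists 1%N, (fun k e => (peval e POne)%:P); first exact: fpolyC.
  by move=> k e y; rewrite hornerC.
- exists N, (fun k e => - p k e); first exact: fpolyN.
  by move=> k e y; rewrite hornerN pE.
- exists (maxn N M), (fun k e => p k e + q k e); first exact: fpolyD.
  by move=> k e y; rewrite hornerD pE qE.
- exists (N + M)%N, (fun k e => p k e * q k e); first exact: fpolyM.
  by move=> k e y; rewrite hornerM pE qE.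
Qed.

(** Whether D holds at some value y of the variable x depends on the patterns
    of vanishing that the terms which determine D can have at such a y; the
    environments at which a given pattern occurs form the projection of a
    locally closed set. *)
Lemma udef_ex1 (x : T) (D : fpred T) :
  udef D -> udef (fun k e => exists y, D k (upd e x y)).
Proof.
move=> [A [L LP]]; have [s sP] := boolp.choice (fun a => fpoly_term x (L a)).
have sP' a := sP a.
pose R (f : {ffun A -> bool}) : fpred T := fun k e => exists y,
  forall a, f a = (peval (upd e x y) (L a) == 0).
apply: (@udef_dep T {ffun A -> bool} R) => [f|k K e e' RR]; last first.
  have half (k1 k2 : closedFieldType) (e1 : T -> k1) (e2 : T -> k2) :
      (forall f, R f k1 e1 -> R f k2 e2) ->
      (exists y, D k1 (upd e1 x y)) -> exists y, D k2 (upd e2 x y).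
    move=> R12 [y Dy].
    have [|z zP] := R12 [ffun a => peval (upd e1 x y) (L a) == 0].
      by exists y => a; rewrite ffunE.
    exists z; apply: (LP _ _ _ _ _).1 Dy => a; have := zP a; rewrite ffunE => e12.
    by split=> /eqP e0; apply/eqP; move: e0; rewrite e12.
  by split; apply: half => f /RR.
have [g gP] := fpoly_term x (pprod (enum [pred a | ~~ f a]) L).
apply: udef_ext (udef_cell [seq s a | a <- enum [pred a | f a]] g) => k e.
rewrite /cell /roots; split=> -[y Hy]; exists y; rewrite all_map in Hy *.
  move=> a; case: Hy => /allP fs gy; apply/idP/idP => [fa|].
    by rewrite -sP' -rootE; apply: fs; rewrite mem_enum.
  apply: contraTT => fa; move: gy; rewrite rootE gP peval_prod.
  rewrite (big_rem a) ?mem_enum //=; apply: contra => /eqP->.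
  by rewrite mul0r.
split.
  apply/allP => a; rewrite mem_enum inE => fa.
  by rewrite /= rootE sP' -Hy.
rewrite rootE gP peval_prod prodf_seq_neq0; apply/allP => a.
by rewrite mem_enum inE /= -Hy.
Qed.

Lemma udef_ex (xs : seq T) (D : fpred T) : udef D ->
  udef (fun k e => exists w, (forall z, z \notin xs -> w z = e z) /\ D k w).
Proof.
move=> DU; elim: xs => [|x xs IHxs].
  apply: udef_ext DU => k e; split=> [De|[w [we]]]; first by exists e.
  by have -> : w = e by apply/funext => z; exact: we.
apply: udef_ext (udef_ex1 x IHxs) => k e; split=> [[y [w [we Dw]]]|[w [we Dw]]].
  exists w; split=> // z; rewrite inE negb_or => /andP[zx zxs].
  by rewrite we // /upd (negbTE zx).
exists (w x), w; split=> // z zxs; rewrite /upd; case: eqVneq => [->//|zx].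
by apply: we; rewrite inE negb_or zx.
Qed.

End Fpoly.

Definition sum_env (T S K : Type) (e : T -> K) (w : S -> K) (z : T + S) : K :=
  match z with inl x => e x | inr x => w x end.

Lemma udef_ex_sum (T : eqType) (S : finType) (D : fpred (T + S)%type) :
  udef D -> udef (fun k (e : T -> k) => exists w : S -> k, D k (sum_env e w)).
Proof.
move=> DU; pose xs : seq (T + S) := [seq inr x | x <- enum S].
apply: udef_ext (udef_subst
  (fun z => match z with inl x => PVar x | inr x => PZero end)
  (udef_ex xs DU)) => k e.
have inl_xs x : inl x \notin xs by apply/mapP => -[].
split=> [[w [we Dw]]|[w Dw]].
  exists (fun x => w (inr x)); move: Dw; congr (D k _); apply/funext=> -[x|x] //=.
  exact: we.
exists (sum_env e w); split=> // -[x|x] //.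
by case/negP; apply/mapP; exists x; rewrite ?mem_enum.
Qed.

(** * Hilbert's basis theorem *)

Section Noetherian.

Definition ideal_set (P : comPzRingType) (J : set P) : Prop :=
  [/\ J 0, forall x y, J x -> J y -> J (x + y) & forall a x, J x -> J (a * x)].

(** An intersection of ideals, so that no linear combinations need to be
    written. *)
Definition generated (P : comPzRingType) (B : set P) : set P :=
  [set x | forall K, ideal_set K -> B `<=` K -> K x].

Lemma generated_ideal (P : comPzRingType) (B : set P) : ideal_set (generated B).
Proof.
split=> [K [K0 _ _] _ //|x y Bx By K Ki BK|a x Bx K Ki BK].
  by have [_ + _] := Ki; apply; [exact: Bx|exact: By].
by have [_ _ +] := Ki; apply; exact: Bx.
Qed.

Lemma sub_generated (P : comPzRingType) (B : set P) : B `<=` generated B.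
Proof. by move=> x Bx K _; exact. Qed.

Definition noetherian (P : comPzRingType) : Prop :=
  forall J : set P, ideal_set J ->
    exists2 r : seq P, [set` r] `<=` J & J `<=` generated [set` r].

Lemma ideal_opp (P : comPzRingType) (J : set P) x : ideal_set J -> J x -> J (- x).
Proof. by move=> [_ _ JM] Jx; rewrite -mulN1r; exact: JM. Qed.

Lemma noetherian_int : noetherian int.
Proof.
move=> J [J0 JD JM]; have [[x [Jx x0]]|N] := pselect (exists x, J x /\ x != 0); last first.
  exists [::] => // x Jx; have -> : x = 0 by apply: contrapT => /eqP x0; case: N; exists x.
  by have [] := @generated_ideal int [set` [::]].
have ex : exists n, `[< (0 < n)%N /\ J n%:Z >].
  exists `|x|%N; apply/asboolP; rewrite absz_gt0; split=> //.
  rewrite abszEsign; apply: JM. exact: Jx.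
case: (ex_minnP ex) => n /asboolP[n0 Jn] nmin.
exists [:: n%:Z] => [y|y Jy K [_ _ KM] nK]; first by rewrite /= inE => /eqP->.
have n0' : n%:Z != 0 by rewrite -lt0n in n0 *.
have /dvdzP[q ->] : (n %| y)%Z.
  apply/dvdz_mod0P; apply: contrapT => /eqP r0.
  have Jr : J (y %% n)%Z.
    rewrite /modz; apply: JD => //; rewrite -mulNr; exact: JM.
  have rn : ((y %% n)%Z < n)%R by rewrite ltz_pmod // ltz_nat.
  have r_ge0 := modz_ge0 y n0'.
  case: (y %% n)%Z Jr rn r0 r_ge0 => // r Jr; rewrite ltz_nat => rn r0 _.
  suff /nmin : `[< (0 < r)%N /\ J r%:Z >] by rewrite leqNgt rn.
  by apply/asboolP; split=> //; rewrite lt0n.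
by apply: KM; apply: nK; rewrite /= inE.
Qed.

(** The leading coefficients of the elements of degree at most d of an ideal
    of polynomials form an increasing sequence of ideals L d, which is
    eventually constant; finitely many elements of the ideal account for the
    generators of L 0, ..., L D, where D is the stationary index. *)
Lemma noetherian_poly (P : comNzRingType) : noetherian P -> noetherian {poly P}.
Proof.
move=> Pn J Ji; have [J0 JD JM] := Ji.
pose lead (I : set {poly P}) d : set P :=
  [set a | exists f, [/\ I f, (size f <= d.+1)%N & f`_d = a]].
have lead_ideal I d : ideal_set I -> ideal_set (lead I d).
  move=> [I0 ID IM]; split.
  - by exists 0; rewrite size_poly0 coef0.
  - move=> _ _ [f [If fd <-]] [g [Ig gd <-]]; exists (f + g); split.
    + exact: ID.
    + by rewrite (leq_trans (size_polyD _ _)) // geq_max fd.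
    + by rewrite coefD.
  - move=> a _ [f [If fd <-]]; exists (a%:P * f); split; first exact: IM.
    + by rewrite mul_polyC (leq_trans (size_scale_leq _ _)).
    + by rewrite coefCM.
have leadS I d e : ideal_set I -> (d <= e)%N -> lead I d `<=` lead I e.
  move=> [_ _ IM] de _ [f [If fd <-]]; exists ('X^(e - d) * f); split.
  - exact: IM.
  - have [->|f0] := eqVneq f 0; first by rewrite mulr0 size_poly0.
    rewrite (leq_trans (size_polyMleq _ _)) // size_polyXn addSn /=.
    by rewrite (leq_trans (leq_add (leqnn _) fd)) // addnS subnK.
  - by rewrite coefXnM ltnNge leq_subr /= subKn.
have [D LD] : exists D, forall d, lead J d `<=` lead J D.
  have [|r rL Lr] := Pn (\bigcup_d lead J d).
    split.
    - by exists 0%N => //; have [] := lead_ideal J 0%N Ji.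
    - move=> x y [d _ dx] [e _ ey]; exists (maxn d e) => //.
      have [_ + _] := lead_ideal J (maxn d e) Ji; apply.
        by apply: leadS dx => //; exact: leq_maxl.
      by apply: leadS ey => //; exact: leq_maxr.
    - move=> a x [d _ dx]; exists d => //.
      by have [_ _ +] := lead_ideal J d Ji; apply.
  have [D rD] : exists D, [set` r] `<=` lead J D.
    elim: r rL {Lr} => [|a r IHr] rL; first by exists 0%N.
    have [|D rD] := IHr; first by move=> x xr; apply: rL; rewrite /= inE xr orbT.
    have [|d _ da] := rL a; first by rewrite /= mem_head.
    exists (maxn d D) => x /=; rewrite inE => /predU1P[->|xr].
      by apply: leadS da => //; exact: leq_maxl.
    by apply: leadS (rD _ xr) => //; exact: leq_maxr.
  exists D => d x dx; apply: Lr; [by exists d|exact: lead_ideal|exact: rD].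
have leadF d : exists2 F : seq {poly P}, [set` F] `<=` J &
    lead J d `<=` lead (generated [set` F]) d.
  have [r rL Lr] := Pn _ (lead_ideal J d Ji).
  have [F FJ rF] : exists2 F : seq {poly P}, [set` F] `<=` J &
      [set` r] `<=` lead [set` F] d.
    elim: r rL {Lr} => [|a r IHr] rL; first by exists [::].
    have [|F FJ rF] := IHr; first by move=> x xr; apply: rL; rewrite /= inE xr orbT.
    have [|f [Jf fd fa]] := rL a; first by rewrite /= mem_head.
    exists (f :: F) => x /=; rewrite inE => /predU1P[->|xF] //; first exact: FJ.
      by exists f; rewrite /= mem_head.
    have [g [Fg gd gx]] := rF _ xF.
    by exists g; split=> //; rewrite /= inE [g \in F]Fg orbT.
  exists F => // a /Lr; apply; first exact/lead_ideal/generated_ideal.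
  move=> x /rF[f [Ff fd fx]]; exists f; split=> //; exact: sub_generated.
have leadU (F F' : seq {poly P}) d :
    {subset F <= F'} -> lead (generated [set` F]) d `<=` lead (generated [set` F']) d.
  move=> FF' _ [f [Ff fd <-]]; exists f; split=> // K Ki F'K.
  by apply: Ff => // x /FF'/F'K.
have [F FJ FL] : exists2 F : seq {poly P}, [set` F] `<=` J &
    forall d, (d <= D)%N -> lead J d `<=` lead (generated [set` F]) d.
  elim: (D) => [|n [F FJ FL]].
    by have [F FJ FL] := leadF 0%N; exists F => // d; rewrite leqn0 => /eqP->.
  have [F' F'J F'L] := leadF n.+1; exists (F ++ F') => [x /=|d].
    by rewrite mem_cat => /orP[/FJ|/F'J].
  rewrite leq_eqVlt => /predU1P[->|dn] a.
    by move=> /F'L; apply: leadU => x xF; rewrite mem_cat xF orbT.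
  by move=> /(FL _ dn); apply: leadU => x xF; rewrite mem_cat xF.
exists F => // f; have [n] := ubnP (size f); elim: n => // n IHn in f *.
rewrite ltnS => fn Jf; have Fi := generated_ideal [set` F].
have [->|f0] := eqVneq f 0; first by have [] := Fi.
have [g [Fg gf gE]] : lead (generated [set` F]) (size f).-1 (lead_coef f).
  have Lf : lead J (size f).-1 (lead_coef f).
    by exists f; rewrite prednK // size_poly_gt0.
  have [fD|/ltnW Df] := leqP (size f).-1 D; first exact: FL.
  by apply: leadS Df _ _ => //; apply: FL => //; exact: LD Lf.
have Jg : J g by apply: Fg.
rewrite -(subrK g f); have [_ + _] := Fi; apply=> //.
apply: IHn; last by apply: JD => //; exact: ideal_opp.
have sf : (size f).-1.+1 = size f by rewrite prednK // size_poly_gt0.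
apply: leq_trans fn; rewrite -sf ltnS; apply/leq_sizeP => i.
rewrite leq_eqVlt => /predU1P[<-|fi]; first by rewrite coefB gE lead_coefE subrr.
rewrite coefB !nth_default ?subrr //; last by rewrite -sf.
by rewrite (leq_trans gf).
Qed.

(** The ring is an iterated polynomial ring over the integers. *)
Lemma noetherian_presentation m : exists (P : comNzRingType) (X : 'I_m -> P),
  [/\ noetherian P, forall p, exists t, p = peval X t
    & forall (R : comNzRingType) (v : 'I_m -> R),
        exists f : {rmorphism P -> R}, forall i, f (X i) = v i].
Proof.
elim: m => [|m [P [X [Pn XS Xf]]]].
  exists int, (fun=> 0); split; first exact: noetherian_int; last first.
    by move=> R v; exists intr => -[].
  have nat_term n : exists t : pterm 'I_0, n%:Z = peval (fun=> 0) t.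
    elim: n => [|n [t tn]]; first by exists PZero; rewrite peval0.
    by exists (PAdd POne t); rewrite /= -tn.
  case=> n; first exact: nat_term.
  by have [t tn] := nat_term n.+1; exists (POpp t); rewrite NegzE /= -tn.
pose X' (i : 'I_m.+1) : {poly P} := if unlift ord0 i is Some j then (X j)%:P else 'X.
exists {poly P}, X'; split; first exact: noetherian_poly.
  elim/poly_ind => [|p c [t tp]]; first by exists PZero; rewrite peval0.
  have [u uc] := XS c.
  exists (PAdd (PMul t (PVar ord0)) (psubst (fun j => PVar (lift ord0 j)) u)).
  have X0 : X' ord0 = 'X by rewrite /X' unlift_none.
  rewrite /= X0 -tp peval_subst uc peval_morph; congr (_ + _).
  by apply: eq_peval => j; rewrite /= /X' liftK.
move=> R v; have [f fX] := Xf R (v \o lift ord0).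
exists (horner_eval (v ord0) \o map_poly f) => i /=.
rewrite /X' /horner_eval; case: unliftP => [j ->|->].
  by rewrite map_polyC hornerC /= fX.
by rewrite map_polyX hornerX.
Qed.

(** The values in a polynomial ring of the terms of I form an ideal, which has
    finitely many generators. *)
Lemma finite_equations m (I : set (pterm 'I_m)) :
    I PZero -> (forall t u, I t -> I u -> I (PAdd t u)) ->
    (forall t u, I u -> I (PMul t u)) ->
  exists2 r : seq (pterm 'I_m), [set` r] `<=` I &
    forall (R : comNzRingType) (v : 'I_m -> R),
      (forall t, t \in r -> peval v t = 0) -> forall t, I t -> peval v t = 0.
Proof.
move=> I0 ID IM; have [P [X [Pn XS Xf]]] := noetherian_presentation m.
have [|r rI Ir] := Pn [set x | exists2 t, I t & x = peval X t].
  split.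
  - by exists PZero; rewrite ?peval0.
  - by move=> _ _ [t It ->] [u Iu ->]; exists (PAdd t u) => //; exact: ID.
  - by move=> a _ [t It ->]; have [u ->] := XS a; exists (PMul u t) => //; exact: IM.
have [r' r'I rr'] : exists2 r' : seq (pterm 'I_m), [set` r'] `<=` I &
    {subset r <= [seq peval X t | t <- r']}.
  elim: r rI {Ir} => [|x r IHr] rI; first by exists [::].
  have [|r' r'I rr'] := IHr; first by move=> y yr; apply: rI; rewrite /= inE yr orbT.
  have [|t It xt] := rI x; first by rewrite /= mem_head.
  exists (t :: r') => y /=; rewrite inE => /predU1P[->|yr] //.
  - exact: r'I.
  - by rewrite xt mem_head.
  - by rewrite inE rr' ?orbT.
exists r' => // R v vr t It; have [f fX] := Xf R v.
have fE u : peval v u = f (peval X u).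
  by rewrite peval_morph; apply: eq_peval => i; rewrite fX.
rewrite fE; apply: (Ir _ _ [set x | f x = 0]) => [||x xr]; first by exists t.
  split; first exact: rmorph0.
    by move=> x y /= fx fy; rewrite rmorphD fx fy addr0.
  by move=> a x /= fx; rewrite rmorphM fx mulr0.
have /mapP[u ur' ->] := rr' _ xr.
by rewrite /= -fE vr.
Qed.

End Noetherian.

(** * The ring with given generators and a given class of points *)

Section UniversalRing.
Local Open Scope quotient_scope.
Variables (T : countType) (C : forall R : comPzRingType, (T -> R) -> Prop).

(** The quotient by this relation plays the role of the subring generated by
    the coordinate functions in the product of the rings R over all the points
    in the class C, a product over a proper class. *)
Definition same_value (t u : pterm T) : bool :=
  `[< forall (R : comPzRingType) (e : T -> R), C e -> peval e t = peval e u >].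

Lemma same_value_refl : reflexive same_value.
Proof. by move=> t; apply/asboolP. Qed.

Lemma same_value_sym : symmetric same_value.
Proof. by move=> t u; apply/asboolP/asboolP => tu R e eC; rewrite tu. Qed.

Lemma same_value_trans : transitive same_value.
Proof.
by move=> t u v /asboolP ut /asboolP tv; apply/asboolP => R e eC; rewrite ut ?tv.
Qed.

Canonical same_value_equiv :=
  EquivRel same_value same_value_refl same_value_sym same_value_trans.

Definition value_ring := {eq_quot same_value_equiv}.
HB.instance Definition _ := Choice.on value_ring.

Lemma valueP (t u : pterm T) :
  (forall (R : comPzRingType) (e : T -> R), C e -> peval e t = peval e u) ->
  \pi_value_ring t = \pi_value_ring u.
Proof. by move=> tu; apply/eqmodP/asboolP. Qed.

Lemma value_repr (t : pterm T) (R : comPzRingType) (e : T -> R) :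
  C e -> peval e (repr (\pi_value_ring t)) = peval e t.
Proof.
have /eqmodP/asboolP H : \pi_value_ring (repr (\pi_value_ring t)) = \pi_value_ring t.
  by rewrite reprK.
exact: H.
Qed.

Let vadd (x y : value_ring) := \pi_value_ring (PAdd (repr x) (repr y)).
Let vmul (x y : value_ring) := \pi_value_ring (PMul (repr x) (repr y)).
Let vopp (x : value_ring) := \pi_value_ring (POpp (repr x)).
Let vone := \pi_value_ring POne.
Let vzero := \pi_value_ring PZero.

Let vaddA : associative vadd.
Proof.
move=> x y z; rewrite /vadd; apply: valueP => R e eC /=.
by rewrite !value_repr //= addrA.
Qed.

Let vaddC : commutative vadd.
Proof. by move=> x y; apply: valueP => R e eC /=; rewrite addrC. Qed.

Let vadd0 : left_id vzero vadd.
Proof.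
move=> x; rewrite -[RHS]reprK; apply: valueP => R e eC.
by rewrite [LHS]/= value_repr // peval0 add0r.
Qed.

Let vaddN : left_inverse vzero vopp vadd.
Proof.
move=> x; apply: valueP => R e eC.
by rewrite [LHS]/= value_repr // peval0 addNr.
Qed.

HB.instance Definition _ := GRing.isZmodule.Build value_ring vaddA vaddC vadd0 vaddN.

Let vmulA : associative vmul.
Proof.
move=> x y z; apply: valueP => R e eC /=.
by rewrite !value_repr //= mulrA.
Qed.

Let vmulC : commutative vmul.
Proof. by move=> x y; apply: valueP => R e eC /=; rewrite mulrC. Qed.

Let vmul1 : left_id vone vmul.
Proof.
move=> x; rewrite -[RHS]reprK; apply: valueP => R e eC /=.
by rewrite value_repr // mul1r.
Qed.

Let vmulDl : left_distributive vmul vadd.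
Proof.
move=> x y z; apply: valueP => R e eC /=.
by rewrite !value_repr //= mulrDl.
Qed.

HB.instance Definition _ :=
  GRing.Zmodule_isComPzRing.Build value_ring vmulA vmulC vmul1 vmulDl.

Definition value_var (x : T) : value_ring := \pi_value_ring (PVar x).

Lemma peval_value t : peval value_var t = \pi_value_ring t.
Proof.
elim: t => [x||t IH|t IHt u IHu|t IHt u IHu] //=.
- by rewrite IH; apply: valueP => R e eC /=; rewrite value_repr.
- by rewrite IHt IHu; apply: valueP => R e eC /=; rewrite !value_repr.
- by rewrite IHt IHu; apply: valueP => R e eC /=; rewrite !value_repr.
Qed.

Lemma value_ring_surj (a : value_ring) : exists t, a = peval value_var t.
Proof. by exists (repr a); rewrite peval_value reprK. Qed.

Lemma value_ring_point (R : comPzRingType) (e : T -> R) : C e ->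
  exists f : {rmorphism value_ring -> R}, forall x, f (value_var x) = e x.
Proof.
move=> eC; pose f (a : value_ring) := peval e (repr a).
have fB : zmod_morphism f.
  move=> a b; rewrite /f.
  by rewrite value_repr //= value_repr.
have fM : monoid_morphism f.
  by split; [rewrite /f value_repr|move=> a b; rewrite /f value_repr].
pose fA := GRing.isZmodMorphism.Build _ _ f fB.
pose fR := GRing.isMonoidMorphism.Build _ _ f fM.
pose F : {rmorphism value_ring -> R} := HB.pack f fA fR.
by exists F => x; rewrite /= /f value_repr.
Qed.

End UniversalRing.

(** * Coordinates of the points of a group scheme of finite type *)

Lemma rmorphism_eq (A R : comPzRingType) (x y : {rmorphism A -> R}) :
  x =1 y -> x = y.
Proof.
move=> /funext; case: x y => f [[fA] [fM]] [g [[gA] [gM]]] /= fg.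
case: _ / fg gA gM => gA gM.
by congr (GRing.RMorphism.Pack (GRing.RMorphism.Class _ _));
  [congr Algebra.isNmodMorphism.Axioms_|congr GRing.isMonoidMorphism.Axioms_];
  exact: Prop_irrelevance.
Qed.

Lemma finite_type_generators (G : affine_group_scheme) : finite_type G ->
  exists (m : nat) (gen : 'I_m -> Defs.coord G), forall a, exists t, a = peval gen t.
Proof.
move=> [s sP]; exists (size s), (tnth (in_tuple s)).
pose S : {pred Defs.coord G} :=
  [pred a | `[< exists t, a = peval (tnth (in_tuple s)) t >]].
move=> a; apply/asboolP; apply: (sP S) => [|b bs].
  split; first by apply/asboolP; exists POne.
    move=> _ _ /asboolP[t ->] /asboolP[u ->]; apply/asboolP.
    by exists (PAdd t (POpp u)).
  move=> _ _ /asboolP[t ->] /asboolP[u ->]; apply/asboolP.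
  by exists (PMul t u).
apply/asboolP; have /tnthP[i ->] : b \in in_tuple s by [].
by exists (PVar i).
Qed.

Section Coordinates.
Variables (G : affine_group_scheme) (m : nat) (gen : 'I_m -> Defs.coord G).
Hypothesis genS : forall a, exists t, a = peval gen t.

Definition coords (R : comPzRingType) (x : points G R) : 'I_m -> R :=
  fun i => (x : {rmorphism _ -> _}) (gen i).

Lemma coords_inj (R : comPzRingType) : injective (@coords R).
Proof.
move=> x y xy; apply: rmorphism_eq => a; have [t ->] := genS a.
by rewrite !peval_morph -![fun i => _]/(coords _) xy.
Qed.

Lemma coords_map (R S : comPzRingType) (f : {rmorphism R -> S}) (x : points G R) :
  coords (points_map G f x) = fun i => f (coords x i).
Proof. by []. Qed.

Lemma coords_surj (R : comPzRingType) (v : 'I_m -> R) :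
  (forall t, peval gen t = 0 -> peval v t = 0) ->
  exists x : points G R, coords x = v.
Proof.
move=> v0; have vE t u : peval gen t = peval gen u -> peval v t = peval v u.
  move=> tu; apply/eqP; rewrite -subr_eq0; apply/eqP/(v0 (PAdd t (POpp u))).
  by rewrite /= tu subrr.
have [h hP] := boolp.choice genS.
pose f a := peval v (h a).
have fE t : f (peval gen t) = peval v t by apply: vE; rewrite -hP.
have fB : zmod_morphism f.
  by move=> a b; rewrite {1}(hP a) {1}(hP b) (fE (PAdd (h a) (POpp (h b)))).
have fM : monoid_morphism f.
  split; first exact: (fE POne).
  by move=> a b; rewrite {1}(hP a) {1}(hP b) (fE (PMul (h a) (h b))).
pose fA := GRing.isZmodMorphism.Build _ _ f fB.
pose fR := GRing.isMonoidMorphism.Build _ _ f fM.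
pose F : {rmorphism Defs.coord G -> R} := HB.pack f fA fR.
by exists F; apply/funext => i; exact: (fE (PVar i)).
Qed.

(** The polynomials are the coordinates of the product of two universal points,
    with values in the universal ring for pairs of points; by naturality of the
    multiplication they serve for all pairs of points, as images of that one. *)
Lemma mul_polynomial : exists M : 'I_m -> pterm ('I_m + 'I_m),
  forall (R : comPzRingType) (x y : points G R) i,
    coords (x * y)%g i = peval (sum_env (coords x) (coords y)) (M i).
Proof.
pose C (R : comPzRingType) (e : 'I_m + 'I_m -> R) :=
  exists x y : points G R, e = sum_env (coords x) (coords y).
pose U := value_ring C; pose v := @value_var _ C.
(* The two universal points. *)
have pointU (b : bool) : exists z : points G U,
    coords z = fun i => v (if b then inl i else inr i).
  apply: coords_surj => t t0.
  pose s i : pterm ('I_m + 'I_m) := PVar (if b then inl i else inr i).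
  rewrite -[peval _ t](peval_subst v s) peval_value -(peval0 v) peval_value.
  apply: valueP => R _ [x [y ->]].
  rewrite peval_subst peval0.
  case: b {v} @s => s.
    by rewrite -(rmorph0 (x : {rmorphism _ -> _})) -t0 peval_morph.
  by rewrite -(rmorph0 (y : {rmorphism _ -> _})) -t0 peval_morph.
have [xu xuE] := pointU true; have [yu yuE] := pointU false.
have /boolp.choice[M MP] : forall i, exists t, coords (xu * yu)%g i = peval v t.
  by move=> i; exact: value_ring_surj.
exists M => R x y i.
have [|f fP] := @value_ring_point _ C R (sum_env (coords x) (coords y)).
  by exists x, y.
have fx : points_map G f xu = x.
  by apply: coords_inj; rewrite coords_map xuE; apply/funext => j; exact: fP.
have fy : points_map G f yu = y.
  by apply: coords_inj; rewrite coords_map yuE; apply/funext => j; exact: fP.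
rewrite -{1}fx -{1}fy -points_mapM coords_map MP peval_morph.
by apply: eq_peval => z; rewrite fP.
Qed.

Lemma coords_closed : exists r : seq (pterm 'I_m),
  forall (R : comNzRingType) (v : 'I_m -> R),
    (exists x : points G R, coords x = v) <-> (forall t, t \in r -> peval v t = 0).
Proof.
have [|||r rI rP] := @finite_equations m [set t | peval gen t = 0].
- exact: peval0.
- by move=> t u /= -> ->; rewrite addr0.
- by move=> t u /= ->; rewrite mulr0.
exists r => R v; split=> [[x <-] t /rI t0|/rP vr]; last exact: coords_surj.
by rewrite -(rmorph0 (x : {rmorphism _ -> _})) -t0 peval_morph.
Qed.

End Coordinates.

(** * Definable predicates on families of points *)

Section PointDef.
Variables (G : affine_group_scheme) (m : nat) (gen : 'I_m -> Defs.coord G).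
Hypothesis genS : forall a, exists t, a = peval gen t.

Notation coords := (coords gen).

Definition env_coords (J : Type) (k : comPzRingType) (X : J -> points G k) :
  J * 'I_m -> k := fun z => coords (X z.1) z.2.

Notation ppred J := (forall k : closedFieldType, (J -> points G k) -> Prop).

Definition pdef (J : Type) (D : ppred J) : Prop :=
  exists2 D' : fpred (J * 'I_m), udef D' & forall k X, D k X <-> D' k (env_coords X).

Section Boolean.
Variable J : Type.
Implicit Types D : ppred J.

Lemma pdef_ext D D' : (forall k X, D k X <-> D' k X) -> pdef D -> pdef D'.
Proof. by move=> DD' [E EU DE]; exists E => // k X; rewrite -DD'. Qed.

Lemma pdef_not D : pdef D -> pdef (fun k X => ~ D k X).
Proof.
move=> [E EU DE]; exists (fun k e => ~ E k e); first exact: udef_not.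
by move=> k X; rewrite DE.
Qed.

Lemma pdef_and D D' : pdef D -> pdef D' -> pdef (fun k X => D k X /\ D' k X).
Proof.
move=> [E EU DE] [E' E'U DE']; exists (fun k e => E k e /\ E' k e).
  exact: udef_and.
by move=> k X; rewrite DE DE'.
Qed.

Lemma pdef_cst (P : Prop) : pdef (fun k (X : J -> points G k) => P).
Proof. by exists (fun _ _ => P) => //; exact: udef_cst. Qed.

Lemma pdef_forall (A : finType) (P : A -> ppred J) :
  (forall a, pdef (P a)) -> pdef (fun k X => forall a, P a k X).
Proof.
move=> PU; pose E a := sval (cid2 (PU a)).
exists (fun k e => forall a, E a k e).
  by apply: udef_forall => a; rewrite /E; case: cid2.
move=> k X; split=> H a; have := H a; rewrite /E; case: cid2 => E' _ PE' /=.
  by rewrite PE'.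
by rewrite PE'.
Qed.

Lemma pdef_exists (A : finType) (P : A -> ppred J) :
  (forall a, pdef (P a)) -> pdef (fun k X => exists a, P a k X).
Proof.
move=> PU; have := @pdef_forall A (fun a k X => ~ P a k X).
move=> /(_ (fun a => pdef_not (PU a)))/pdef_not; apply: pdef_ext => k X.
split=> [/existsNP[a /contrapT Pa]|[a Pa] H]; first by exists a.
exact: H Pa.
Qed.

(** The finitely many predicates P have finitely many patterns of truth values,
    and D holds exactly for those patterns which occur in some field together
    with D. *)
Lemma pdef_dep (A : finType) (P : A -> ppred J) D :
  (forall a, pdef (P a)) ->
  (forall (k K : closedFieldType) (X : J -> points G k) (Y : J -> points G K),
     (forall a, P a k X <-> P a K Y) -> D k X -> D K Y) ->
  pdef D.
Proof.
move=> PU PD; pose good (s : {ffun A -> bool}) := exists (k : closedFieldType)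
  (X : J -> points G k), D k X /\ forall a, P a k X <-> s a.
apply: (pdef_ext (D := fun k X =>
  exists s, good s /\ forall a, P a k X <-> s a)) => [k X|]; last first.
  apply: pdef_exists => s; apply: pdef_and; first exact: pdef_cst.
  apply: pdef_forall => a; case: (s a).
    by apply: pdef_ext (PU a) => k X; split=> [//|[_ /(_ isT)]].
  by apply: pdef_ext (pdef_not (PU a)) => k X; split=> [//|[H _] /H].
split=> [[s [[k' [X' [DX' Xs']]] Xs]]|DX].
  by apply: PD DX' => a; rewrite Xs' Xs.
have Ps a : P a k X <-> [ffun a => `[< P a k X >]] a.
  by rewrite ffunE; split=> /asboolP.
by exists [ffun a => `[< P a k X >]]; split=> //; exists k, X.
Qed.

End Boolean.

Lemma pdef_rename (J J' : Type) (s : J -> J') (D : ppred J) :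
  pdef D -> pdef (fun k (X : J' -> points G k) => D k (X \o s)).
Proof.
move=> [E EU DE]; exists (fun k e => E k (fun z => peval e (PVar (s z.1, z.2)))).
  exact: udef_subst.
by move=> k X; exact: DE.
Qed.

Lemma pdef_transfer (J : Type) (D : ppred J) (k K : closedFieldType)
    (f : {rmorphism k -> K}) (X : J -> points G k) :
  pdef D -> D k X <-> D K (fun j => points_map G f (X j)).
Proof.
by move=> [E EU DE]; rewrite !DE; exact: udef_transfer.
Qed.

Lemma pdef_sentence (D : ppred void) (k K : closedFieldType) (p : nat) :
  has_char k p -> has_char K p -> pdef D ->
  D k (of_void _) <-> D K (of_void _).
Proof.
move=> kp Kp [E EU DE]; rewrite !DE.
have E0 (k' : closedFieldType) : env_coords (of_void (points G k')) = fun=> 0.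
  by apply/funext; case=> -[].
by rewrite !E0; exact: udef_sentence kp Kp EU.
Qed.

(** A quantifier over points is a quantifier over coordinates, restricted by the
    finitely many equations of the image of the coordinates. *)
Lemma pdef_ex (J : eqType) (S : finType) (D : ppred (J + S)%type) :
  pdef D ->
  pdef (fun k (X : J -> points G k) => exists Y : S -> points G k, D k (sum_env X Y)).
Proof.
move=> [E EU DE]; have [r rP] := coords_closed genS.
pose reassoc (z : (J + S) * 'I_m) : pterm (J * 'I_m + S * 'I_m) :=
  PVar (match z.1 with inl j => inl (j, z.2) | inr s => inr (s, z.2) end).
have EU' := udef_subst reassoc EU.
have CU : udef (fun k (e : J * 'I_m + S * 'I_m -> k) => forall (s : S) (i : 'I_(size r)),
    peval e (psubst (fun j => PVar (inr (s, j))) (tnth (in_tuple r) i)) = 0).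
  by apply: udef_forall => s; apply: udef_forall => i; exact: udef_eq0.
refine (ex_intro2 _ _ _ (udef_ex_sum (udef_and CU EU')) _) => k X.
split=> [[Y DXY]|[w [wr Ew]]].
  exists (env_coords Y); split.
    move=> s i; rewrite peval_subst /=.
    by apply: ((rP k (coords (Y s))).1 _ _ (mem_tnth i (in_tuple r))); exists (Y s).
  move/DE: DXY; congr (E k _); apply/funext => -[[j|s] i] //.
have /boolp.choice[Y YP] : forall s, exists x : points G k, coords x = fun i => w (s, i).
  move=> s; apply/rP => t tr.
  have /tnthP[i ->] : t \in in_tuple r by [].
  by have := wr s i; rewrite peval_subst.
exists Y; apply/DE; move: Ew; congr (E k _); apply/funext => -[[j|s] i] //=.
by rewrite /env_coords /= YP.
Qed.

Definition ppoly (J : Type)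
    (F : forall k : closedFieldType, (J -> points G k) -> points G k) : Prop :=
  exists t : 'I_m -> pterm (J * 'I_m),
    forall k X i, coords (F k X) i = peval (env_coords X) (t i).

Lemma ppoly_var (J : Type) (j : J) : ppoly (fun k X => X j).
Proof. by exists (fun i => PVar (j, i)). Qed.

Lemma ppoly_mul (J : Type) F F' : @ppoly J F -> ppoly F' ->
  ppoly (fun k X => (F k X * F' k X)%g).
Proof.
move=> [t tP] [t' t'P]; have [M MP] := mul_polynomial genS.
exists (fun i => psubst (sum_env t t') (M i)) => k X i.
rewrite MP peval_subst; apply: eq_peval => -[j|j] /=; [exact: tP|exact: t'P].
Qed.

Lemma pdef_eq (J : Type) F F' : @ppoly J F -> ppoly F' ->
  pdef (fun k X => F k X = F' k X).
Proof.
move=> [t tP] [t' t'P].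
exists (fun k e => forall i, peval e (PAdd (t i) (POpp (t' i))) = 0).
  by apply: udef_forall => i; exact: udef_eq0.
move=> k X; split=> [FF' i|tt'].
  by rewrite /= -tP -t'P FF' subrr.
apply: (coords_inj genS); apply/funext => i.
by apply/eqP; rewrite -subr_eq0 tP t'P; apply/eqP/tt'.
Qed.

End PointDef.

(** * Chains given by coefficients and simplices *)

Section Chains.
Variables (R : nzRingType) (gp : groupType).

Definition chn (I : finType) (n : nat) (b : I -> R) (h : I -> n.-tuple gp) :
  bar_chain R gp n := \sum_i b i *: << h i >>.

Lemma chn_ffun (I : finType) n (b : I -> R) (h : I -> n.-tuple gp) :
  chn [ffun i => b i] h = chn b h.
Proof. by apply: eq_bigr => i _; rewrite ffunE. Qed.

Lemma mcoeff_chn (I : finType) n (b : I -> R) (h : I -> n.-tuple gp) x :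
  (chn b h)@_x = \sum_(i | h i == x) b i.
Proof.
rewrite /chn raddf_sum /= [RHS]big_mkcond /=; apply: eq_bigr => i _.
by rewrite mcoeffZ mcoeffU; case: eqP; rewrite ?mulr1 ?mulr0.
Qed.

Lemma chn_eq0 (I : finType) n (b : I -> R) (h : I -> n.-tuple gp) :
  chn b h = 0 <-> forall i, \sum_(j | h j == h i) b j = 0.
Proof.
split=> [b0 i|H]; first by rewrite -mcoeff_chn b0 mcoeff0.
apply/malgP => x; rewrite mcoeff0 mcoeff_chn.
have [[i /eqP <-]|N] := pselect (exists i, h i == x); first exact: H.
by rewrite big_pred0 // => i; apply/negP => hi; apply: N; exists i.
Qed.

Lemma chn_d (I : finType) n (b : I -> R) (h : I -> n.+1.-tuple gp) :
  bar_d (chn b h) = chn (fun z : I * 'I_n.+2 => b z.1 * (-1) ^+ z.2)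
                        (fun z => bar_face (h z.1) z.2).
Proof.
rewrite /chn /bar_d linear_sum /= -(pair_bigA _ (fun i (j : 'I_n.+2) =>
  (b i * (-1) ^+ j) *: << bar_face (h i) j >>)) /=.
apply: eq_bigr => i _; rewrite linearZ /= lin_extU scaler_sumr.
by apply: eq_bigr => j _; rewrite scalerA.
Qed.

Definition sum_coef (I I' : Type) (b : I -> R) (b' : I' -> R) : I + I' -> R :=
  sum_env b (fun i => - b' i).

Lemma chnB (I I' : finType) n (b : I -> R) (b' : I' -> R)
    (h : I -> n.-tuple gp) (h' : I' -> n.-tuple gp) :
  chn b h - chn b' h' = chn (sum_coef b b') (sum_env h h').
Proof.
rewrite /chn big_sumType /=; congr (_ + _); rewrite -sumrN.
by apply: eq_bigr => i _; rewrite scaleNr.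
Qed.

Lemma chain_size_chn M n (b : 'I_M -> R) (h : 'I_M -> n.-tuple gp) :
  (chain_size (chn b h) <= M)%N.
Proof.
rewrite /chain_size -[leqRHS]size_enum_ord -(size_map h).
apply: uniq_leq_size => [|x]; first exact: fset_uniq.
rewrite -mcoeff_neq0 mcoeff_chn; apply: contraR => xN.
rewrite big_pred0 // => i; apply/negP => /eqP hi; case/mapP: xN.
by exists i; rewrite ?mem_enum.
Qed.

Lemma chnP n (c : bar_chain R gp n) M : (chain_size c <= M)%N ->
  exists (b : 'I_M -> R) (h : 'I_M -> n.-tuple gp), c = chn b h.
Proof.
move=> cM; pose x0 : n.-tuple gp := [tuple 1%g | i < n].
pose s : seq (n.-tuple gp) := msupp c.
exists (fun i => if (i < size s)%N then c@_(nth x0 s i) else 0).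
exists (fun i => nth x0 s i).
rewrite {1}[c]monalgE -/s (big_nth x0) big_mkord /chn.
rewrite (big_ord_widen M (fun i => << c@_(nth x0 s i) *g nth x0 s i >>)) //.
rewrite big_mkcond; apply: eq_bigr => i _; case: ifP => _; rewrite ?scale0r //.
by apply/malgP => x; rewrite mcoeffZ !mcoeffU mulrnAr mulr1.
Qed.

End Chains.

(** The coefficient of a simplex is the sum of the b i over the indices i at
    which it occurs, hence depends only on the coincidences between simplices.
    The two groups may differ, as the points of G over different fields do. *)
Lemma chn_eq0_pattern (R : nzRingType) (gp gp' : groupType) (I : finType) n n'
    (b : I -> R) (h : I -> n.-tuple gp) (h' : I -> n'.-tuple gp') :
  (forall i j, h i = h j <-> h' i = h' j) -> chn b h = 0 -> chn b h' = 0.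
Proof.
move=> hh' /chn_eq0 h0; apply/chn_eq0 => i; rewrite -[RHS](h0 i).
by apply: eq_bigl => j; apply/eqP/eqP => /hh'.
Qed.

Lemma chain_map_chn (R : nzRingType) (gp gp' : groupType)
    (f : {multiplicative gp -> gp'}) (I : finType) n
    (b : I -> R) (h : I -> n.-tuple gp) :
  chain_map f (chn b h) = chn b (fun i => map_tuple f (h i)).
Proof.
rewrite /chn linear_sum; apply: eq_bigr => i _.
by rewrite linearZ /= /chain_map lin_extU.
Qed.

(** * Definability of the boundary relations *)

Definition tup (T : Type) (I : Type) n (X : I * 'I_n -> T) (i : I) : n.-tuple T :=
  [tuple X (i, j) | j < n].

Definition untup (T : Type) (I : Type) n (h : I -> n.-tuple T) (z : I * 'I_n) : T :=
  tnth (h z.1) z.2.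

Lemma untupK T I n (h : I -> n.-tuple T) : tup (untup h) = h.
Proof.
by apply/funext => i; apply: eq_from_tnth => j; rewrite tnth_mktuple.
Qed.

Section ChainDef.
Variables (G : affine_group_scheme) (m : nat) (gen : 'I_m -> Defs.coord G).
Hypothesis genS : forall a, exists t, a = peval gen t.
Variable l : nat.

Notation ppred J := (forall k : closedFieldType, (J -> points G k) -> Prop).
Notation pdef := (@pdef G m gen).
Notation ppoly := (ppoly gen).

Definition tpoly (J : Type) n
    (F : forall k : closedFieldType, (J -> points G k) -> n.-tuple (points G k)) :=
  forall j, ppoly (fun k X => tnth (F k X) j).

Lemma tpoly_tup (J I : Type) n (s : I * 'I_n -> J) (i : I) :
  tpoly (fun k (X : J -> points G k) => tup (X \o s) i).
Proof.
move=> j; have [t tP] := ppoly_var gen (s (i, j)); exists t => k X i'.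
by rewrite tnth_mktuple -tP.
Qed.

Lemma tpoly_face (J : Type) n F i : @tpoly J n.+1 F ->
  tpoly (fun k X => bar_face (F k X) i).
Proof.
move=> FP j.
have jn := ltn_ord j.
have nthF q (qn : (q < n.+1)%N) (k : closedFieldType) X :
    nth 1%g (F k X) q = tnth (F k X) (Ordinal qn).
  by rewrite (tnth_nth 1%g).
have nthP q : (q < n.+1)%N -> ppoly (fun k X => nth 1%g (F k X) q).
  by move=> qn; have [t tP] := FP (Ordinal qn); exists t => k X a; rewrite nthF tP.
suff [t tP] : ppoly (fun k X => if (j.+1 < i)%N then nth 1 (F k X) j
    else if j.+1 == i then nth 1 (F k X) j * nth 1 (F k X) j.+1
    else nth 1 (F k X) j.+1)%g.
  by exists t => k X a; rewrite tnth_mktuple tP.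
case: (j.+1 < i)%N; first by apply: nthP; exact: leqW.
case: (j.+1 == i); last exact: nthP.
by apply: (ppoly_mul genS); apply: nthP => //; exact: leqW.
Qed.

Lemma pdef_teq (J : Type) n F F' : @tpoly J n F -> tpoly F' ->
  pdef (fun k X => F k X = F' k X).
Proof.
move=> FP F'P; apply: (pdef_ext (D := fun k X =>
  forall j, tnth (F k X) j = tnth (F' k X) j)) => [k X|].
  by split=> [H|-> //]; exact: eq_from_tnth.
by apply: pdef_forall => j; exact: (pdef_eq genS).
Qed.

Lemma pdef_chn_eq0 (J : Type) n (I : finType) (b : I -> 'Z_l)
    (F : I -> forall k : closedFieldType, (J -> points G k) -> n.-tuple (points G k)) :
  (forall i, tpoly (F i)) -> pdef (fun k X => chn b (fun i => F i k X) = 0).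
Proof.
move=> FP; apply: (@pdef_dep _ _ _ _ (I * I)%type
    (fun z k X => F z.1 k X = F z.2 k X)) => [z|k K X Y H].
  exact: pdef_teq.
by apply: chn_eq0_pattern => i j; exact: (H (i, j)).
Qed.

Lemma pdef_chn_eq (J : Type) n (I I' : finType) (b : I -> 'Z_l) (b' : I' -> 'Z_l)
    (F : I -> forall k : closedFieldType, (J -> points G k) -> n.-tuple (points G k))
    (F' : I' -> forall k : closedFieldType, (J -> points G k) -> n.-tuple (points G k)) :
  (forall i, tpoly (F i)) -> (forall i, tpoly (F' i)) ->
  pdef (fun k X => chn b (fun i => F i k X) = chn b' (fun i => F' i k X)).
Proof.
move=> FP F'P; pose H (z : I + I') :=
  match z with inl i => F i | inr i => F' i end.
apply: pdef_ext (@pdef_chn_eq0 J n _ (sum_coef b b') H _) => [k X|[]//].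
have -> : (fun i => H i k X) = sum_env (fun i => F i k X) (fun i => F' i k X).
  by apply/funext => -[].
rewrite -chnB; split=> [/eqP|->]; last by rewrite subrr.
by rewrite subr_eq0 => /eqP.
Qed.

Lemma pdef_cycle (J : Type) n (I : finType) (b : I -> 'Z_l)
    (F : I -> forall k : closedFieldType, (J -> points G k) -> n.-tuple (points G k)) :
  (forall i, tpoly (F i)) ->
  pdef (fun k X => chn b (fun i => F i k X) \in @is_cycle 'Z_l (points G k) n).
Proof.
case: n F => [|n] F FP.
  apply: pdef_ext (pdef_cst gen J True) => k X.
  by split=> // _; rewrite inE.
apply: pdef_ext (pdef_chn_eq0 (fun z : I * 'I_n.+2 => b z.1 * (-1) ^+ z.2)
  (fun z => tpoly_face z.2 (FP z.1))) => k X.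
by rewrite inE chn_d; split=> [->|/eqP].
Qed.

(** The chains with M simplices are parametrized by their coefficients, for
    which there are finitely many choices, and by points. *)
Lemma pdef_fill (J : eqType) n M (I : finType) (b : I -> 'Z_l)
    (F : I -> forall k : closedFieldType, (J -> points G k) -> n.-tuple (points G k)) :
  (forall i, tpoly (F i)) ->
  pdef (fun k X => exists2 c : bar_chain 'Z_l (points G k) n.+1,
    (chain_size c <= M)%N & bar_d c = chn b (fun i => F i k X)).
Proof.
move=> FP; apply: (pdef_ext (D := fun k X =>
    exists (c : {ffun 'I_M -> 'Z_l}) (Y : 'I_M * 'I_n.+1 -> points G k),
      bar_d (chn c (tup Y)) = chn b (fun i => F i k X))) => [k X|].
  split=> [[c [Y dc]]|[c /chnP[b' [h ->]] dc]].
    by exists (chn c (tup Y)); rewrite ?chain_size_chn.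
  by exists [ffun i => b' i], (untup h); rewrite untupK chn_ffun.
apply: pdef_exists => c.
pose F' (i : I) (k : closedFieldType) (Z : J + 'I_M * 'I_n.+1 -> points G k) :=
  F i k (Z \o inl).
have F'P i : tpoly (F' i).
  move=> j; have [t tP] := FP i j.
  exists (fun a => psubst (fun z => PVar (inl z.1, z.2)) (t a)) => k X a.
  by rewrite tP peval_subst.
have HP (z : 'I_M * 'I_n.+2) : tpoly (fun k (Z : J + 'I_M * 'I_n.+1 -> points G k) =>
    bar_face (tup (Z \o inr) z.1) z.2).
  exact/tpoly_face/tpoly_tup.
have := pdef_ex genS (pdef_chn_eq (fun z : 'I_M * 'I_n.+2 => c z.1 * (-1) ^+ z.2) b HP F'P).
by apply: pdef_ext => k X; split=> -[Y HY]; exists Y; move: HY; rewrite chn_d.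
Qed.

Lemma pdef_size (J : eqType) n M (I : finType) (b : I -> 'Z_l)
    (F : I -> forall k : closedFieldType, (J -> points G k) -> n.-tuple (points G k)) :
  (forall i, tpoly (F i)) ->
  pdef (fun k X => (chain_size (chn b (fun i => F i k X)) <= M)%N).
Proof.
move=> FP; apply: (pdef_ext (D := fun k X =>
    exists (c : {ffun 'I_M -> 'Z_l}) (Y : 'I_M * 'I_n -> points G k),
      chn c (tup Y) = chn b (fun i => F i k X))) => [k X|].
  split=> [[c [Y <-]]|]; first exact: chain_size_chn.
  move=> /chnP[b' [h ->]].
  by exists [ffun i => b' i], (untup h); rewrite untupK chn_ffun.
apply: pdef_exists => c.
pose F' (i : I) (k : closedFieldType) (Z : J + 'I_M * 'I_n -> points G k) :=
  F i k (Z \o inl).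
have F'P i : tpoly (F' i).
  move=> j; have [t tP] := FP i j.
  exists (fun a => psubst (fun z => PVar (inl z.1, z.2)) (t a)) => k X a.
  by rewrite tP peval_subst.
have HP i : tpoly (fun k (Z : J + 'I_M * 'I_n -> points G k) => tup (Z \o inr) i).
  exact: tpoly_tup.
have := pdef_ex genS (pdef_chn_eq c b HP F'P).
by apply: pdef_ext => k X; split=> -[Y HY]; exists Y.
Qed.

End ChainDef.

(** * Boundaries are cycles *)

Section BoundaryCycle.
Variables (R : nzRingType) (gp : groupType).

Let face (g : nat -> gp) (i j : nat) : gp :=
  (if (j.+1 < i)%N then g j else if j.+1 == i then g j * g j.+1 else g j.+1)%g.

Let faceC (g : nat -> gp) i j : (i <= j)%N ->
  face (face g i) j =1 face (face g j.+1) i.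
Proof.
move=> ij q; rewrite /face.
do ![case: ltngtP => ?; try by (exfalso; lia)].
all: rewrite ?mulgA //.
Qed.

Lemma nth_bar_face n (g : n.+1.-tuple gp) i q : (q < n)%N ->
  nth 1%g (bar_face g i) q = face (nth 1%g g) i q.
Proof. by move=> qn; rewrite -(tnth_nth _ _ (Ordinal qn)) tnth_mktuple. Qed.

Lemma bar_faceC n (g : n.+2.-tuple gp) i j : (i <= j)%N ->
  bar_face (bar_face g i) j = bar_face (bar_face g j.+1) i.
Proof.
move=> ij; apply: eq_from_tnth => q; have qn := ltn_ord q.
have E a b : tnth (bar_face (bar_face g a) b) q = face (face (nth 1%g g) a) b q.
  rewrite (tnth_nth 1%g) nth_bar_face // /face !nth_bar_face //; exact: leqW.
by rewrite !E faceC.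
Qed.

(** The simplicial identities match the terms with i <= j and those with j < i,
    which have opposite signs. *)
Lemma bar_d_bar_d n (c : bar_chain R gp n.+1) : bar_d (bar_d c) = 0.
Proof.
case: n c => [//|n] c.
rewrite /bar_d /= (lin_ext_comp (lin_ext _)).
rewrite (eq_lin_ext (h' := fun=> 0)); last first.
  move=> g /=; rewrite linear_sum /=.
  pose T (i : 'I_n.+3) (j : 'I_n.+2) : bar_chain R gp n :=
    (-1) ^+ (i + j) *: << bar_face (bar_face g i) j >>.
  have -> : \sum_(i < n.+3) lin_ext (fun g : n.+1.-tuple gp =>
      \sum_(j < n.+2) (-1) ^+ j *: (<< bar_face g j >> : bar_chain R gp n))
      ((-1) ^+ i *: << bar_face g i >>) = \sum_(z : 'I_n.+3 * 'I_n.+2) T z.1 z.2.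
    rewrite -(pair_bigA _ T) /=; apply: eq_bigr => i _.
    rewrite linearZ /= lin_extU scaler_sumr; apply: eq_bigr => j _.
    by rewrite scalerA -exprD.
  rewrite (bigID (fun z : 'I_n.+3 * 'I_n.+2 => (z.1 <= z.2)%N)) /=.
  apply/eqP; rewrite addr_eq0 -sumrN; apply/eqP.
  (* The term (i, j) with i <= j cancels with the term (j + 1, i). *)
  pose u (z : 'I_n.+3 * 'I_n.+2) : 'I_n.+3 * 'I_n.+2 :=
    (lift ord0 z.2, inord z.1).
  pose v (z : 'I_n.+3 * 'I_n.+2) : 'I_n.+3 * 'I_n.+2 :=
    (inord z.2, inord z.1.-1).
  rewrite [RHS](reindex_onto u v) /=.
    apply: eq_big => [[i j]|[i j] /= ij] /=.
      rewrite /u /v /= xpair_eqE -!(inj_eq val_inj) /= /bump /= add1n /=.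
      have w := ltn_ord (inord i : 'I_n.+2); have j' := ltn_ord j.
      rewrite (inordK (ltnW w : _ < n.+3)%N) add0n (inordK j') eqxx andbT.
      have [ij|ji] := leqP i j.
        have -> : (inord i : 'I_n.+2) = i :> nat by rewrite inordK //; lia.
        by rewrite eqxx andbT -leqNgt; lia.
      by apply/esym/negP => /andP[+ /eqP iE]; rewrite iE; lia.
    have iE : (inord i : 'I_n.+2) = i :> nat by rewrite inordK //; have := ltn_ord j; lia.
    rewrite /T /u /= iE bar_faceC // /bump /= add1n addSn exprS mulN1r scaleNr opprK.
    by rewrite addnC.
  move=> [i j] /= ij; have := ltn_ord i; have := ltn_ord j => jn iN.
  rewrite /u /v /=; congr (_, _); apply: val_inj => /=.
    by rewrite /bump /= add1n inordK; lia.
  by rewrite !inordK //; lia.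
by rewrite /lin_ext big1 // => x _; rewrite scaler0.
Qed.

Lemma boundary_cycle n (b : bar_chain R gp n) :
  b \in @is_boundary R gp n -> b \in @is_cycle R gp n.
Proof. by case/is_boundaryP=> c <-; rewrite inE bar_d_bar_d. Qed.

End BoundaryCycle.

(** * Fillings *)

Section Fillable.
Variables (R : nzRingType) (gp : groupType) (n : nat).
Implicit Types b c : bar_chain R gp n.

Definition fillable (M : nat) b : Prop :=
  exists2 c : bar_chain R gp n.+1, (chain_size c <= M)%N & bar_d c = b.

Lemma fillableW M N b : (M <= N)%N -> fillable M b -> fillable N b.
Proof. by move=> MN [c cM cb]; exists c => //; exact: leq_trans MN. Qed.

Lemma fillableB M N b c :
  fillable M b -> fillable N c -> fillable (M + N) (b - c).
Proof.
move=> [b' b'M <-] [c' c'N <-]; exists (b' - c').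
  rewrite (leq_trans (fsubset_leq_card (msuppB_le _ _))) //.
  by rewrite (leq_trans (leq_card_fsetU _ _).1) // leq_add.
exact: (raddfB (@bar_d R gp n.+1)).
Qed.

Lemma boundary_fillable b :
  b \in @is_boundary R gp n <-> exists M, fillable M b.
Proof.
split=> [/is_boundaryP[c cb]|[M [c _ cb]]].
  by exists (chain_size c), c.
by apply/is_boundaryP; exists c.
Qed.

Lemma fill_normP b M : b \in @is_boundary R gp n ->
  fill_norm b = M <-> fillable M b /\ forall i : 'I_M, ~ fillable i b.
Proof.
move=> bB; rewrite /fill_norm; case: xgetP => [N _ [[c cb cN] Nmin]|N].
  have Nfill : fillable N b by exists c; rewrite // -cN.
  have Nle i : fillable i b -> (N <= i)%N.
    move=> [c' c'i c'b]; apply: leq_trans c'i.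
    by apply: (Nmin (chain_size c')); exists c'.
  split=> [<-|[MF Mmin]].
    by split=> // i /Nle; rewrite leqNgt ltn_ord.
  apply/eqP; rewrite eqn_leq Nle //= leqNgt; apply/negP => NM.
  exact: (Mmin (Ordinal NM)).
have ex : exists M, `[< fillable M b >].
  by have [M' MF] := (boundary_fillable b).1 bB; exists M'; apply/asboolP.
case: (ex_minnP ex) => M' /asboolP[c cM' cb] M'min.
case: (N (chain_size c)); split; first by exists c.
move=> _ [c' c'b <-]; apply: leq_trans (cM') _; apply: M'min.
by apply/asboolP; exists c'.
Qed.

Lemma homology_class_fillable (z z' : bar_cycle R gp n) :
  homology_class z = homology_class z' <->
  exists M, fillable M (chain_of_cycle z - chain_of_cycle z').
Proof. by rewrite homology_class_eq -boundary_fillable inE. Qed.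

End Fillable.

(** * Cycles of a given shape up to bounded fillings *)

Section Shapes.
Variables (G : affine_group_scheme) (m : nat) (gen : 'I_m -> Defs.coord G).
Hypothesis genS : forall a, exists t, a = peval gen t.
Variables (n l p : nat).

Notation pdef := (@pdef G m gen).
Notation cycle b h := (chn b h \in @is_cycle 'Z_l (points G _) n).

Lemma chn_ex (gp : groupType) (c : bar_chain 'Z_l gp n) :
  exists M (b : {ffun 'I_M -> 'Z_l}) h, c = chn b h.
Proof.
have [b [h cE]] := chnP (leqnn (chain_size c)).
by exists _, [ffun i => b i], h; rewrite chn_ffun.
Qed.

Lemma tup_map (k K : closedFieldType) (iota : {rmorphism k -> K}) (I : Type)
    (X : I * 'I_n -> points G k) (i : I) :
  tup (fun z => points_map G iota (X z)) i = map_tuple (points_map G iota) (tup X i).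
Proof.
apply: eq_from_tnth => j.
by rewrite /tup tnth_mktuple tnth_map tnth_mktuple.
Qed.

(** Having a filling with M simplices is definable, so that it descends. *)
Lemma fillable_reflect (k K : closedFieldType) (iota : {rmorphism k -> K}) M
    (c : bar_chain 'Z_l (points G k) n) :
  fillable M (chain_map (points_map G iota) c) -> fillable M c.
Proof.
have [N [b [h ->]]] := chn_ex c; rewrite chain_map_chn -[h]untupK => hM.
have FP i : tpoly gen (fun k (X : 'I_N * 'I_n -> points G k) => tup (X \o id) i).
  exact: tpoly_tup.
apply: (pdef_transfer iota (untup h) (pdef_fill genS M b FP)).2; move: hM.
by congr (fillable M (chn b _)); apply/funext => i; rewrite tup_map.
Qed.

Section Shape.
Variables (K : nat) (b : 'I_K -> 'Z_l).

(** The point Y (s, i, j) is the entry j of the simplex i of the cycle s. *)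
Definition covering (M r : nat) (k : closedFieldType)
    (Y : 'I_r * 'I_K * 'I_n -> points G k) : Prop :=
  (forall s, cycle b (fun i => tup Y (s, i))) /\
  forall h, cycle b h ->
    exists s, fillable M (chn b h - chn b (fun i => tup Y (s, i))).

Definition finitely_covered : Prop :=
  exists M r, forall k : closedFieldType, has_char k p ->
    exists Y : 'I_r * 'I_K * 'I_n -> points G k, covering M Y.

Lemma pdef_fillableB (J : eqType) M (h h' : 'I_K * 'I_n -> J) :
  pdef (fun k (X : J -> points G k) =>
    fillable M (chn b (tup (X \o h)) - chn b (tup (X \o h')))).
Proof.
pose F (z : 'I_K + 'I_K) (k : closedFieldType) (X : J -> points G k) :=
  match z with inl i => tup (X \o h) i | inr i => tup (X \o h') i end.
have FP z : tpoly gen (F z) by case: z => i; exact: tpoly_tup.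
apply: pdef_ext (pdef_fill genS M (sum_coef b b) FP) => k X.
rewrite chnB /fillable.
have -> // : sum_env (tup (X \o h)) (tup (X \o h')) = fun z => F z k X.
by apply/funext => -[].
Qed.

Lemma pdef_shape_cycle (J : Type) (h : 'I_K * 'I_n -> J) :
  pdef (fun k (X : J -> points G k) => cycle b (tup (X \o h))).
Proof. by apply: pdef_cycle => // i; exact: tpoly_tup. Qed.

Lemma pdef_covering M r : pdef (@covering M r).
Proof.
apply: pdef_and.
  apply: pdef_forall => s.
  exact: (@pdef_shape_cycle _ (fun z : 'I_K * 'I_n => (s, z.1, z.2))).
pose J := ('I_r * 'I_K * 'I_n + 'I_K * 'I_n)%type.
have := pdef_ex genS (pdef_and (@pdef_shape_cycle J inr)
  (pdef_forall (fun s : 'I_r => pdef_not (@pdef_fillableB J M inr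
    (fun z => inl (s, z.1, z.2)))))).
move=> /pdef_not; apply: pdef_ext => k Y; split=> [N h hc|H [X [Xc XN]]].
  apply: contrapT => /forallNP hN; apply: N; exists (untup h).
  rewrite -[h]untupK in hc hN; split; first exact: hc.
  by move=> s; exact: (hN s).
by have [s] := H _ Xc; exact: XN.
Qed.

(** For given M and r the existence of a covering is a sentence. *)
Lemma finitely_covered_of_one (k : closedFieldType) M r :
  has_char k p -> (exists Y, @covering M r k Y) -> finitely_covered.
Proof.
move=> kp kY; exists M, r => K' K'p.
exact: ((pdef_sentence kp K'p (pdef_ex genS (pdef_rename
  (fun z => inr z : void + 'I_r * 'I_K * 'I_n) (pdef_covering M r)))).1 kY).
Qed.

End Shape.

(** * The case where all shapes are finitely covered *)

Section FinitelyCovered.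
Hypothesis cov : forall K (b : 'I_K -> 'Z_l), finitely_covered b.

Lemma class_representatives (k : closedFieldType) K (b : 'I_K -> 'Z_l) :
  has_char k p -> exists (M : nat) (zs : seq (bar_cycle 'Z_l (points G k) n)),
    forall h, cycle b h -> exists2 z, z \in zs &
      fillable M (chn b h - chain_of_cycle z).
Proof.
move=> kp; have [M [r /(_ _ kp)[Y [Yc YP]]]] := cov b.
exists M, [seq BarCycle (Yc s) | s <- enum 'I_r] => h /YP[s sP].
by exists (BarCycle (Yc s)) => //; apply: map_f; rewrite mem_enum.
Qed.

Lemma homology_countable (k : closedFieldType) : has_char k p ->
  countable [set: homology 'Z_l (points G k) n].
Proof.
move=> kp.
have clE M (b : {ffun 'I_M -> 'Z_l}) : exists s : seq (homology 'Z_l (points G k) n),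
    forall (h : 'I_M -> n.-tuple (points G k)) (hc : cycle b h),
      homology_class (BarCycle hc) \in s.
  have [N [zs zsP]] := class_representatives b kp.
  exists [seq homology_class z | z <- zs] => h hc.
  have [z zzs hz] := zsP h hc; apply/mapP; exists z => //.
  by apply/homology_class_fillable; exists N.
pose cl M b := sval (cid (@clE M b)).
have clP M b := svalP (cid (@clE M b)).
have -> : [set: homology 'Z_l (points G k) n] =
    \bigcup_(M in [set: nat]) \bigcup_(b in [set: {ffun 'I_M -> 'Z_l}]) [set` cl M b].
  apply/seteqP; split=> // a _; rewrite -(homology_reprK a).
  case: (homology_repr a) => c hc.
  have [M [b [h cE]]] := chn_ex c.
  move: hc; rewrite cE => hc.
  by exists M => //; exists b => //; exact: (clP M b h hc).
apply: bigcup_countable => // M _; apply: bigcup_countable => // b _.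
exact/finite_set_countable/finite_seq.
Qed.

(** Fillings of a given size descend, whence injectivity; a covering over k is
    still a covering over K, whence surjectivity. *)
Lemma homology_map_bijective (k K : closedFieldType) (iota : {rmorphism k -> K}) :
  has_char k p -> has_char K p ->
  is_isomorphism (homology_map 'Z_l (points_map G iota) n).
Proof.
move=> kp Kp; set f := homology_map _ _ _.
have f_inj : injective f.
  move=> a a'; rewrite -(homology_reprK a) -(homology_reprK a') /f !homology_map_class.
  move=> /homology_class_fillable[M] /=; rewrite -raddfB /=.
  by move=> /fillable_reflect cM; apply/homology_class_fillable; exists M.
have f_surj a' : exists a, f a = a'.
  have [M' [b [h cE]]] := chn_ex (chain_of_cycle (homology_repr a')).
  have hc : cycle b h by rewrite -cE; exact: cycleP.
  have [M [r /(_ _ kp)[Y Yc]]] := cov b.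
  have [_ Kcov] := (pdef_transfer iota Y (pdef_covering b M r)).1 Yc.
  have [s sP] := Kcov h hc; have [Yc1 _] := Yc.
  exists (homology_class (BarCycle (Yc1 s))); rewrite -[RHS]homology_reprK.
  rewrite /f homology_map_class; apply/esym/homology_class_fillable; exists M.
  rewrite cE /= chain_map_chn; move: sP; congr (fillable M (_ - chn b _)).
  by apply/funext => i; rewrite tup_map.
have [g gK] := boolp.choice f_surj.
by exists g => // a; apply: f_inj; rewrite gK.
Qed.

End FinitelyCovered.
End Shapes.

(** * The isoperimetric function *)

Section Isop.
Variables (G : affine_group_scheme) (m : nat) (gen : 'I_m -> Defs.coord G).
Hypothesis genS : forall a, exists t, a = peval gen t.
Variables (n l p : nat).

Notation pdef := (@pdef G m gen).

(** The filler norm is expressed through fillings of bounded size only, which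
    makes this condition a sentence. *)
Definition fill_value (K v : nat) (k : closedFieldType) : Prop :=
  exists (b : {ffun 'I_K -> 'Z_l}) (X : 'I_K * 'I_n -> points G k),
    let c := chn b (tup X) in
    [/\ forall i : 'I_K, ~ (chain_size c <= i)%N, fillable v c
      & forall i : 'I_v, ~ fillable i c].

Lemma fill_valueP K v (k : closedFieldType) :
  [set fill_norm b | b in [set b | b \in @is_boundary 'Z_l (points G k) n /\
    chain_size b = K]] v <-> fill_value K v k.
Proof.
split=> [[c [cB cK] /(fill_normP _ cB)[cv vmin]]|[b [X [bK bv vmin]]]].
  have [|b [h cE]] := @chnP _ _ _ c K; first by rewrite cK.
  exists [ffun i => b i], (untup h).
  have -> /= : chn [ffun i => b i] (tup (untup h)) = c.
    by rewrite untupK chn_ffun.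
  by split=> // i; rewrite cK leqNgt ltn_ord.
have bB : chn b (tup X) \in @is_boundary 'Z_l (points G k) n.
  by apply/boundary_fillable; exists v.
exists (chn b (tup X)); last exact/fill_normP.
split=> //; apply/eqP; rewrite eqn_leq chain_size_chn leqNgt.
by apply/negP => sK; exact: (bK (Ordinal sK)).
Qed.

Lemma fill_value_sentence K v (k k' : closedFieldType) :
  has_char k p -> has_char k' p -> fill_value K v k <-> fill_value K v k'.
Proof.
move=> kp k'p.
pose J := (void + 'I_K * 'I_n)%type.
have FP i : tpoly gen (fun k (Z : J -> points G k) => tup (Z \o inr) i).
  exact: tpoly_tup.
have := pdef_sentence kp k'p (pdef_exists (fun b : {ffun 'I_K -> 'Z_l} => pdef_ex genS
  (pdef_and (pdef_forall (fun i : 'I_K => pdef_not (pdef_size genS i b FP)))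
     (pdef_and (pdef_fill genS v b FP)
        (pdef_forall (fun i : 'I_v => pdef_not (pdef_fill genS i b FP))))))).
move=> [kk' k'k]; split=> -[b [X [H1 H2 H3]]].
  have [|b' [X' [? [? ?]]]] := kk'; first by exists b, X.
  by exists b', X'.
have [|b' [X' [? [? ?]]]] := k'k; first by exists b, X.
by exists b', X'.
Qed.

(** A boundary differs by a bounded filling from one of finitely many
    representatives, which is then a boundary as well; so the fillings of the
    boundaries among the representatives yield a bound. *)
Lemma fill_value_bounded K (k : closedFieldType) : has_char k p ->
  (forall K (b : 'I_K -> 'Z_l), finitely_covered G n p b) ->
  exists B, forall v, fill_value K v k -> (v <= B)%N.
Proof.
move=> kp cov.
have /boolp.choice[B BP] : forall b : {ffun 'I_K -> 'Z_l}, exists B, forall X,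
    let c := chn b (tup X) in c \in @is_boundary 'Z_l (points G k) n -> fillable B c.
  move=> b; have [M [zs zsP]] := class_representatives cov b kp.
  have [N NP] : exists N, forall z, z \in zs ->
      chain_of_cycle z \in @is_boundary 'Z_l (points G k) n ->
      fillable N (chain_of_cycle z).
    elim: zs {zsP} => [|z zs [N NP]]; first by exists 0%N.
    have [/boundary_fillable[N' zN']|zN] :=
      pselect (chain_of_cycle z \in @is_boundary 'Z_l (points G k) n).
      exists (maxn N N') => z'; rewrite inE => /predU1P[-> _|z'zs z'B].
        by apply: fillableW zN'; exact: leq_maxr.
      by apply: fillableW (NP _ z'zs z'B); exact: leq_maxl.
    by exists N => z'; rewrite inE => /predU1P[->//|]; exact: NP.
  exists (M + (0 + N))%N => X c cB.
  have [z zzs cz] := zsP _ (boundary_cycle cB).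
  have /boundary_fillable/(NP _ zzs) zN : exists i, fillable i (chain_of_cycle z).
    have [i ci] := (boundary_fillable c).1 cB; exists (i + M)%N.
    by have := fillableB ci cz; rewrite subKr.
  have f0 : fillable 0 (0 : bar_chain 'Z_l (points G k) n).
    by exists 0; rewrite ?raddf0 // /chain_size msupp0 cardfs0.
  by have := fillableB cz (fillableB f0 zN); rewrite sub0r opprK subrK.
exists (\max_b B b)%N => v [b [X [_ cv vmin]]].
rewrite leqNgt; apply/negP => Bv; apply: (vmin (Ordinal Bv)) => /=.
apply: fillableW (leq_bigmax b) (BP _ _ _).
by apply/boundary_fillable; exists v.
Qed.

Lemma nat_supremum (A : set nat) B : (forall v, A v -> (v <= B)%N) ->
  exists s, supremums A s.
Proof.
move=> AB; have ex : exists s, `[< forall v, A v -> (v <= s)%N >].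
  by exists B; apply/asboolP.
case: (ex_minnP ex) => s /asboolP As smin; exists s; split=> [v /As//|u Au].
by apply: smin; apply/asboolP => v /Au.
Qed.

Lemma isoperimetric_function_exists :
  (forall K (b : 'I_K -> 'Z_l), finitely_covered G n p b) ->
  exists isop, forall k : closedFieldType, has_char k p ->
    isoperimetric_function 'Z_l (points G k) n isop.
Proof.
move=> cov; have [[k0 k0p]|N] := pselect (exists k : closedFieldType, has_char k p).
  have /boolp.choice[isop isopP] : forall K, exists s, supremums (fill_value K ^~ k0) s.
    by move=> K; have [B] := fill_value_bounded K k0p cov; exact: nat_supremum.
  exists isop => k kp K.
  suff -> : [set fill_norm b | b in [set b | b \in @is_boundary 'Z_l (points G k) n /\
      chain_size b = K]] = fill_value K ^~ k0 by [].
  by apply/funext => v; apply/propext; rewrite fill_valueP (fill_value_sentence _ _ kp k0p).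
by exists (fun=> 0%N) => k kp; case: N; exists k.
Qed.

End Isop.

(** * Saturation over a small set of parameters *)

Section Saturation.
Variables (k : closedFieldType) (X : Type) (sigma : X -> k).
Hypotheses (nX : embeds nat X) (kX : ~ embeds k X).

(** The elements of L are parameters too: they are the coordinates already
    chosen in the construction of a point. *)
Definition param (L : seq k) (z : X + nat) : k :=
  match z with inl x => sigma x | inr i => nth 0 L i end.

Definition param_env (L : seq k) (u : seq (X + nat)) (i : nat) : k :=
  nth 0 (map (param L) u) i.

Definition param_algebraic (L : seq k) (y : k) : Prop :=
  exists (s : seq (pterm nat)) (u : seq (X + nat)),
    pol (param_env L u) s != 0 /\ root (pol (param_env L u) s) y.

(** An algebraic element is determined by a polynomial and the rank of the
    element among the roots, so that the algebraic elements are no more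
    numerous than X. *)
Lemma exists_transcendental L : exists y, ~ param_algebraic L y.
Proof.
apply: contrapT => N; apply: kX.
have /boolp.choice[g gP] : forall y, exists su : seq (pterm nat) * seq (X + nat),
    pol (param_env L su.2) su.1 != 0 /\ root (pol (param_env L su.2) su.1) y.
  move=> y; have [[s [u su]]|yN] := pselect (param_algebraic L y).
    by exists (s, u).
  by case: N; exists y.
pose r su : seq k := sval (closed_field_poly_normal (pol (param_env L su.2) su.1)).
have yr y : y \in r (g y).
  rewrite /r; case: closed_field_poly_normal => rs /= rsE.
  have [p0] := gP y; rewrite rsE rootZ ?lead_coef_eq0 //.
  by rewrite root_prod_XsubC.
have E1 : embeds k ((seq (pterm nat) * seq (X + nat)) * nat).
  exists (fun y => (g y, index y (r (g y)))) => y y' [gy iy].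
  by rewrite -(nth_index 0 (yr y)) iy gy nth_index.
apply: (embeds_trans E1).
have nXX : embeds (X + nat) X.
  apply: embeds_trans _ (embeds_sum_self nX); have [f fI] := nX.
  exists (fun z => match z with inl x => inl x | inr n => inr (f n) end).
  case=> [x|n] [x'|n'] // [e]; first by rewrite e.
  by rewrite (fI _ _ e).
apply: embeds_trans _ (embeds_square nX); apply: embeds_prod => //.
apply: embeds_trans _ (embeds_square nX); apply: embeds_prod.
  exact: embeds_count.
by apply: embeds_trans _ (embeds_seq_self nX); exact: embeds_seq nXX.
Qed.

Section Family.
Variable T : finType.

Definition param_def (L : seq k) (A : set (T -> k)) : Prop :=
  exists D : fpred (T + nat)%type, udef D /\ exists u,
    forall w, A w <-> D k (sum_env w (param_env L u)).

(** A definable subset of the line that misses a transcendental element is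
    finite, as the nonzero polynomials which define it vanish on it. *)
Lemma projection_finite L A x y0 : param_def L A -> ~ param_algebraic L y0 ->
    (forall w, A w -> w x <> y0) ->
  exists rs : seq k, forall w, A w -> w x \in rs.
Proof.
move=> [D [DU [u AD]]] y0N Ay0.
pose xs : seq (T + nat) := [seq inl z | z <- enum (predC1 x)].
have := udef_ex xs DU; set D' : fpred _ := fun k e => _; move=> [B [M MP]].
pose e0 : T + nat -> k := sum_env (fun=> 0) (param_env L u).
have inr_xs i : inr i \notin xs by apply/mapP => -[].
have x_xs : inl x \notin xs.
  by apply/mapP => -[z]; rewrite mem_enum => zx [xz]; rewrite xz !inE eqxx in zx.
have AD' y : D' k (upd e0 (inl x) y) <-> exists2 w, A w & w x = y.
  split=> [[w [we Dw]]|[w Aw wx]].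
    exists (fun z => w (inl z)); last by rewrite we // upd_same.
    apply/AD; move: Dw; congr (D k _); apply/funext => -[z|i] //=.
    by rewrite we // upd_other.
  exists (sum_env w (param_env L u)); split; last exact/AD.
  move=> [z|i] zN; last by [].
  have [->|zx] := eqVneq z x; first by rewrite upd_same.
  by case/negP: zN; apply/mapP; exists z; rewrite // mem_enum.
have /boolp.choice[s sP] := fun a => fpoly_term (inl x) (M a).
pose s' a := [seq psubst (fun z => match z with inl _ => PZero | inr i => PVar i end) t
  | t <- s a].
have s'E a : pol (param_env L u) (s' a) = pol e0 (s a).
  rewrite /pol -map_comp; congr Poly; apply: eq_map => t /=.
  by rewrite peval_subst; apply: eq_peval => -[z|i] //=; exact: addrN.
pose p a := pol (param_env L u) (s' a).
have pE a y : (p a).[y] = peval (upd e0 (inl x) y) (M a) by rewrite /p s'E sP.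
pose roots_of (q : {poly k}) : seq k := sval (closed_field_poly_normal q).
have rootsP q y : q != 0 -> root q y -> y \in roots_of q.
  move=> q0; rewrite /roots_of; case: closed_field_poly_normal => rs /= rsE.
  by rewrite rsE rootZ ?lead_coef_eq0 // root_prod_XsubC.
exists (flatten [seq roots_of (p a) | a <- enum B]) => w Aw.
apply: contrapT => /negP wN.
have [w' Aw' w'y0] : exists2 w', A w' & w' x = y0; last exact: Ay0 Aw' w'y0.
apply/AD'; apply: (MP _ _ _ _ _).1 ((AD' (w x)).2 _) => [a|]; last by exists w.
rewrite -!pE; have [-> |pa0] := eqVneq (p a) 0; first by rewrite !horner0.
split=> /rootP pr; exfalso.
  case/negP: wN; apply/flattenP; exists (roots_of (p a)).
    by apply/mapP; exists a; rewrite ?mem_enum.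
  exact: rootsP.
by apply: y0N; exists (s' a), u.
Qed.

Definition directed (F : set (set (T -> k))) : Prop :=
  [/\ F !=set0, forall A, F A -> A !=set0
    & forall A B, F A -> F B -> exists2 C, F C & C `<=` A `&` B].

(** If not every projection contains a given transcendental element, then some
    projection is finite, and directedness provides a value in it that is common
    to all of them. *)
Lemma common_coordinate L F x : (forall A, F A -> param_def L A) -> directed F ->
  exists y, forall A, F A -> exists2 w, A w & w x = y.
Proof.
move=> FL [_ Fn0 FI]; have [y0 y0N] := exists_transcendental L.
have [y0A|/existsNP[A0 /not_implyP[FA0 A0y0]]] :=
  pselect (forall A, F A -> exists2 w, A w & w x = y0); first by exists y0.
have [|rs rsP] := projection_finite (FL _ FA0) y0N (x := x).
  by move=> w A0w wy0; apply: A0y0; exists w.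
apply: contrapT => N.
have [C FC [CA0 Crs]] : exists2 C, F C & C `<=` A0 /\
    forall w, C w -> w x \notin rs.
  elim: rs {rsP} => [|y rs [C FC [CA0 Crs]]]; first by exists A0 => //; split.
  have [Ay FAy Ayy] : exists2 A, F A & forall w, A w -> w x <> y.
    apply: contrapT => N'; apply: N; exists y => A FA; apply: contrapT => N.
    by apply: N'; exists A => // w Aw wy; apply: N; exists w.
  have [C' FC' C'C] := FI _ _ FC FAy; exists C' => //; split=> [w /C'C[/CA0]//|w].
  move=> /C'C[Cw Ayw]; rewrite inE negb_or Crs // andbT.
  exact/eqP/Ayy.
have [w Cw] := Fn0 _ FC.
by have := Crs _ Cw; rewrite rsP //; exact: CA0.
Qed.

Lemma param_def_fix L A x y : param_def L A ->
  param_def (y :: L) (A `&` [set w | w x = y]).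
Proof.
move=> [D [DU [u AD]]].
pose s (z : T + nat) : pterm (T + nat) :=
  PVar (match z with inl t => inl t | inr i => inr i.+1 end).
exists (fun k e => D k (fun z => peval e (s z)) /\
    peval e (PAdd (PVar (inl x)) (POpp (PVar (inr 0%N)))) = 0); split.
  by apply: udef_and; [exact: udef_subst|exact: udef_eq0].
pose shift (z : X + nat) : X + nat :=
  match z with inl t => inl t | inr i => inr i.+1 end.
exists (inr 0%N :: map shift u) => w /=; rewrite {2}/param_env /=.
have -> : (fun z => sum_env w (param_env (y :: L) (inr 0%N :: map shift u))
    match z with inl t => inl t | inr i => inr i.+1 end) =
    sum_env w (param_env L u).
  apply/funext => -[t|i] //=; rewrite /param_env /= -map_comp.
  by congr (nth _ _ _); apply: eq_map => -[].
rewrite AD; split=> -[Aw wx]; split=> //; first by rewrite wx subrr.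
by apply/eqP; rewrite -subr_eq0; apply/eqP.
Qed.

Lemma param_defI L A B : param_def L A -> param_def L B -> param_def L (A `&` B).
Proof.
move=> [D [DU [u AD]]] [E [EU [v BE]]].
pose s (z : T + nat) : pterm (T + nat) :=
  PVar (match z with inl t => inl t | inr i => inr (size u + i)%N end).
pose s' (z : T + nat) : pterm (T + nat) :=
  match z with
  | inl t => PVar (inl t)
  | inr i => if (i < size u)%N then PVar (inr i) else PZero
  end.
exists (fun k e => D k (fun z => peval e (s' z)) /\ E k (fun z => peval e (s z))).
split; first by apply: udef_and; exact: udef_subst.
exists (u ++ v) => w; rewrite /= -/(param_env _ _).
have -> : (fun z => peval (sum_env w (param_env L (u ++ v))) (s' z)) =
    sum_env w (param_env L u).
  apply/funext => -[t|i] //=; case: ifP => iu /=.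
    by rewrite /param_env map_cat nth_cat size_map iu.
  by rewrite addrN /param_env nth_default // size_map leqNgt iu.
have -> : (fun z => peval (sum_env w (param_env L (u ++ v))) (s z)) =
    sum_env w (param_env L v).
  apply/funext => -[t|i] //=; rewrite /param_env map_cat nth_cat size_map.
  by rewrite ltnNge leq_addr addKn.
by rewrite -AD -BE.
Qed.

(** The coordinates are chosen one at a time, each chosen value becoming a
    parameter. *)
Theorem saturation F : (forall A, F A -> param_def [::] A) -> directed F ->
  exists w, forall A, F A -> A w.
Proof.
move=> FL Fd.
suff main (xs : seq T) L v E : (forall A, E A -> param_def L A) -> directed E ->
    (forall A w z, E A -> A w -> z \notin xs -> w z = v z) ->
    exists w, forall A, E A -> A w.
  apply: (main (enum T) [::] (fun=> 0) F FL Fd) => A w z _ _.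
  by rewrite mem_enum.
elim: xs => {F FL Fd} [|x xs IHxs] in L v E *; rename E into F.
  move=> _ [_ Fn0 _] Fv; exists v => A FA; have [w Aw] := Fn0 _ FA.
  suff -> : v = w by [].
  by apply/funext => z; rewrite (Fv _ _ z FA Aw).
move=> FL Fd Fv; have [y yF] := common_coordinate x FL Fd; have [Fn _ FI] := Fd.
pose F' := [set A `&` [set w | w x = y] | A in F].
have [||A w z [B FB <-] [Bw /= wx] zxs|w wF'] := IHxs (y :: L) (upd v x y) F'.
- by move=> _ [A FA <-]; apply: param_def_fix; exact: FL.
- split.
  + by have [A FA] := Fn; exists (A `&` [set w | w x = y]); exists A.
  + by move=> _ [A FA <-]; have [w Aw wx] := yF _ FA; exists w.
  + move=> _ _ [A FA <-] [B FB <-]; have [C FC CAB] := FI _ _ FA FB.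
    exists (C `&` [set w | w x = y]); first by exists C.
    by move=> w [/CAB[]].
- rewrite /upd; case: eqVneq => [->//|zx]; apply: Fv FB Bw _.
  by rewrite inE negb_or zx.
- by exists w => A FA; have [] : (A `&` [set w | w x = y]) w by apply: wF'; exists A.
Qed.

End Family.
End Saturation.

(** * The case where some shape is not finitely covered *)

Lemma uncountable_embeds_nat (A : Type) : ~ countable [set: A] -> embeds nat A.
Proof.
move=> Anc; apply: card_le_embeds; apply/infiniteP => Af; apply: Anc.
exact: finite_set_countable.
Qed.

Section NotCovered.
Variables (G : affine_group_scheme) (m : nat) (gen : 'I_m -> Defs.coord G).
Hypothesis genS : forall a, exists t, a = peval gen t.
Variables (n l p : nat) (k : closedFieldType).
Hypotheses (kp : has_char k p) (knc : ~ countable [set: k]).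

Notation cycle b h := (chn b h \in @is_cycle 'Z_l (points G k) n).
Notation H := (homology 'Z_l (points G k) n).

Lemma homology_embeds : embeds H k.
Proof.
have nk := uncountable_embeds_nat knc.
have pk : embeds (points G k) k.
  apply: embeds_trans _ (embeds_seq_self nk).
  exists (fun x => [seq coords gen x i | i <- enum 'I_m]) => x y /eq_in_map xy.
  by apply: (coords_inj genS); apply/funext => i; apply: xy; rewrite mem_enum.
have tk : embeds (n.-tuple (points G k)) k.
  apply: (@embeds_trans _ (seq (points G k))); first by exists val; exact: val_inj.
  exact: embeds_trans (embeds_seq pk) (embeds_seq_self nk).
have ck : embeds (bar_chain 'Z_l (points G k) n) k.
  apply: (@embeds_trans _ (seq ('Z_l * n.-tuple (points G k)))).
    exists (fun c => [seq (c@_x, x) | x <- msupp c]) => c c' cc'.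
    rewrite [c]monalgE [c']monalgE.
    have E (d : bar_chain 'Z_l (points G k) n) : \sum_(x <- msupp d) << d@_x *g x >> =
        \sum_(z <- [seq (d@_x, x) | x <- msupp d]) << z.1 *g z.2 >>.
      by rewrite big_map.
    by rewrite E cc' -E.
  apply: embeds_trans _ (embeds_seq_self nk); apply: embeds_seq.
  apply: embeds_trans _ (embeds_square nk); apply: embeds_prod => //.
  exact: embeds_count.
apply: embeds_trans _ ck; exists (fun a => chain_of_cycle (homology_repr a)).
by move=> a a' /val_inj aa'; rewrite -[a]homology_reprK aa' homology_reprK.
Qed.

Section Few.
Hypothesis kH : ~ embeds k H.

(** An infinite homology absorbs the factor nat, and a finite or countable one
    is too small because k is uncountable. *)
Lemma few_parameters : embeds nat (H * nat) /\ ~ embeds k (H * nat).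
Proof.
split; first by exists (fun i => (0, i)) => i j [].
have [nH|Hn] := embeds_total nat H => kHn; last first.
  apply: knc; have /embeds_card_le// : embeds k nat.
  apply: embeds_trans kHn _; apply: (@embeds_trans _ (nat * nat)%type).
    by apply: embeds_prod => //; exists id.
  by apply: embeds_count; exists id.
apply: kH; apply: embeds_trans kHn _; apply: embeds_trans _ (embeds_square nH).
by apply: embeds_prod => //; exists id.
Qed.

Variables (K : nat) (b : 'I_K -> 'Z_l).

Notation T := ('I_K * 'I_n * 'I_m)%type.

Definition has_cycle (a : H) : Prop :=
  exists h (hc : cycle b h), homology_class (BarCycle hc) = a.

Variable rep : H -> 'I_K -> n.-tuple (points G k).
Hypothesis repP : forall a, has_cycle a ->
  exists hc : cycle b (rep a), homology_class (BarCycle hc) = a.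

(** The parameters: the coordinates of the chosen representatives, numbered by
    pickle. *)
Definition rep_coord (z : H * nat) : k :=
  if @choice.unpickle T z.2 is Some t then env_coords gen (untup (rep z.1)) t else 0.

Notation pdefk := (@param_def k (H * nat) rep_coord T [::]).

Definition avoiding (a : H) (M : nat) : set (T -> k) :=
  [set w | exists h, [/\ w = env_coords gen (untup h), cycle b h
    & ~ fillable M (chn b h - chn b (rep a))]].

Definition cycle_coords : set (T -> k) :=
  [set w | exists2 h, w = env_coords gen (untup h) & cycle b h].

Lemma points_udef : exists2 D : fpred T, udef D &
  forall w, D k w <-> exists h : 'I_K -> n.-tuple (points G k), w = env_coords gen (untup h).
Proof.
have [r rP] := coords_closed genS.
exists (fun k w => forall (j : 'I_K * 'I_n) (i : 'I_(size r)),
    peval w (psubst (fun a => PVar (j, a)) (tnth (in_tuple r) i)) = 0).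
  by apply: udef_forall => j; apply: udef_forall => i; exact: udef_eq0.
move=> w; split=> [wr|[h ->] j i]; last first.
  rewrite peval_subst /=.
  by apply: ((rP k (coords gen (untup h j))).1 _ _ (mem_tnth i (in_tuple r)));
    exists (untup h j).
have /boolp.choice[Y YP] : forall j, exists x : points G k,
    coords gen x = fun i => w (j, i).
  move=> j; apply/rP => t tr; have /tnthP[i ->] : t \in in_tuple r by [].
  by have := wr j i; rewrite peval_subst.
exists (tup Y); apply/funext => -[[i j] a].
rewrite /env_coords /untup /= tnth_mktuple.
by rewrite -[RHS]/(coords gen (Y (i, j)) a) YP.
Qed.

Lemma param_def_cycle : pdefk cycle_coords.
Proof.
have [D DU DP] := points_udef.
have [E EU EP] := @pdef_shape_cycle G m gen genS n l K b _ (id : _ -> 'I_K * 'I_n).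
pose s (t : T) : pterm (T + nat) := PVar (inl t).
exists (fun k e => D k (fun t => peval e (s t)) /\ E k (fun t => peval e (s t))); split.
  by apply: udef_and; exact: udef_subst.
exists [::] => w /=; rewrite DP; split=> [[h -> hc]|[[h wh] Ew]].
  split; first by exists h.
  by apply/(EP k (untup h)); rewrite [X in chn b X](untupK h).
exists h; first exact: wh.
have := (EP k (untup h)).2; rewrite [X in chn b X](untupK h); apply.
by rewrite -wh.
Qed.

Lemma param_def_avoiding a M : pdefk (avoiding a M).
Proof.
have [D [DU [u DP]]] := param_def_cycle.
have [E EU EP] := @pdef_fillableB G m gen genS n l K b
  ('I_K * 'I_n + 'I_K * 'I_n)%type M inl inr.
pose s (z : ('I_K * 'I_n + 'I_K * 'I_n) * 'I_m) : pterm (T + nat) :=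
  match z.1 with
  | inl j => PVar (inl (j, z.2))
  | inr j => PVar (inr (index (j, z.2) (enum {: T})))
  end.
have nEdef : pdefk [set w | ~ E k (fun z => match z.1 with
    | inl j => w (j, z.2) | inr j => env_coords gen (untup (rep a)) (j, z.2) end)].
  exists (fun k e => ~ E k (fun z => peval e (s z))); split.
    by apply: udef_not; exact: udef_subst.
  exists [seq inl (a, choice.pickle t) | t <- enum {: T}] => w /=.
  suff -> : (fun z => peval (sum_env w (param_env rep_coord [::]
      [seq inl (a, choice.pickle t) | t <- enum {: T}])) (s z)) = fun z => match z.1 with
    | inl j => w (j, z.2) | inr j => env_coords gen (untup (rep a)) (j, z.2) end by [].
  apply/funext => -[[j|j] i] //=; rewrite /param_env -map_comp.
  rewrite (nth_map (j, i)) ?index_mem ?mem_enum // nth_index ?mem_enum //=.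
  by rewrite /rep_coord /= choice.pickleK.
have EE h : fillable M (chn b h - chn b (rep a)) <->
    E k (fun z => match z.1 with
      | inl j => env_coords gen (untup h) (j, z.2)
      | inr j => env_coords gen (untup (rep a)) (j, z.2) end).
  have hl : tup (sum_env (untup h) (untup (rep a)) \o inl) = h by exact: untupK.
  have hr : tup (sum_env (untup h) (untup (rep a)) \o inr) = rep a by exact: untupK.
  have := EP k (sum_env (untup h) (untup (rep a))); rewrite hl hr => ->.
  suff -> : env_coords gen (sum_env (untup h) (untup (rep a))) = fun z => match z.1 with
      | inl j => env_coords gen (untup h) (j, z.2)
      | inr j => env_coords gen (untup (rep a)) (j, z.2) end by [].
  by apply/funext => -[[j|j] i].
suff -> : avoiding a M = cycle_coords `&` [set w | ~ E k (fun z => match z.1 with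
    | inl j => w (j, z.2) | inr j => env_coords gen (untup (rep a)) (j, z.2) end)].
  exact: param_defI param_def_cycle nEdef.
apply/seteqP; split=> w.
  by move=> [h [-> hc hM]]; split; [exists h|rewrite /= -EE].
by move=> [[h -> hc] /=]; rewrite -EE => hM; exists h.
Qed.

Lemma coords_untup_inj (h h' : 'I_K -> n.-tuple (points G k)) :
  env_coords gen (untup h) = env_coords gen (untup h') -> h = h'.
Proof.
move=> hh'; rewrite -[h]untupK -[h']untupK; congr (tup _).
apply/funext => z; apply: (coords_inj genS); apply/funext => i.
exact: (congr1 (fun e => e (z, i)) hh').
Qed.

Definition avoiding_all (s : seq H) (M : nat) : set (T -> k) :=
  foldr (fun a A => A `&` avoiding a M) cycle_coords s.

Lemma avoiding_allP s M w : avoiding_all s M w <->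
  cycle_coords w /\ forall a, a \in s -> avoiding a M w.
Proof.
elim: s => [|a s IHs] /=; first by split=> [?|[]].
split=> [[/IHs[wc ws] wa]|[wc ws]].
  split; first exact: wc.
  move=> a'; rewrite in_cons => /orP.
  case=> [/eqP->|a's].
    exact: wa.
  exact: ws.
split; last by apply: ws; rewrite mem_head.
by apply/IHs; split=> // a' a's; apply: ws; rewrite in_cons a's orbT.
Qed.

Lemma param_def_avoiding_all s M : pdefk (avoiding_all s M).
Proof.
elim: s => [|a s IHs] /=; first exact: param_def_cycle.
exact: param_defI IHs (param_def_avoiding a M).
Qed.

(** If finitely many classes never suffice to cover the cycles with coefficients
    b, then by saturation some cycle is at no bounded distance from any of the
    representatives, although one of these represents its own class. *)
Lemma few_finitely_covered : finitely_covered G n p b.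
Proof.
apply: contrapT => ncov.
pose F : set (set (T -> k)) := [set A | exists s M,
  (forall a, a \in s -> has_cycle a) /\ A = avoiding_all s M].
have [nX kX] := few_parameters.
have [w wF] : exists w, forall A, F A -> A w.
  apply: (@saturation k _ rep_coord nX kX T).
    by move=> _ [s [M [_ ->]]]; exact: param_def_avoiding_all.
  split; first by exists (avoiding_all [::] 0%N), [::], 0%N.
    move=> _ [s [M [sc ->]]]; apply: contrapT => /nonemptyPn A0.
    apply: ncov; apply: (finitely_covered_of_one genS (k := k) (M := M) (r := size s) kp).
    pose hs (z : 'I_(size s) * 'I_K) := rep (tnth (in_tuple s) z.1) z.2.
    exists (untup hs); split=> [i|h hc].
      have /sc/repP[hc _] := mem_tnth i (in_tuple s).
      by rewrite untupK; exact: hc.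
    apply: contrapT => /forallNP N.
    have : avoiding_all s M (env_coords gen (untup h)).
      apply/avoiding_allP; split; first by exists h.
      move=> a /(nthP 0)[i si ai]; exists h; split=> // hM.
      apply: (N (Ordinal si)); rewrite untupK.
      by rewrite /hs /= (tnth_nth 0) /= ai.
    by rewrite A0.
  move=> _ _ [s [M [sc ->]]] [s' [M' [sc' ->]]].
  exists (avoiding_all (s ++ s') (maxn M M')).
    exists (s ++ s'), (maxn M M'); split=> // a.
    by rewrite mem_cat => /orP[/sc|/sc'].
  have mono a N N' : (N <= N')%N -> avoiding a N' `<=` avoiding a N.
    move=> NN' w [h [wh hc hN]]; exists h; split=> // hN'; apply: hN.
    exact: fillableW hN'.
  move=> w /avoiding_allP[wc wa]; split; apply/avoiding_allP; split=> // a as_.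
    by apply: mono (wa a _); rewrite ?leq_maxl // mem_cat as_.
  by apply: mono (wa a _); rewrite ?leq_maxr // mem_cat as_ orbT.
have [h wh hc] : cycle_coords w.
  by apply: (wF (avoiding_all [::] 0%N)); exists [::], 0%N.
pose a := homology_class (BarCycle hc).
have ca : has_cycle a by exists h, hc.
have [hc' /esym/homology_class_fillable[M hM]] := repP ca.
have : avoiding_all [:: a] M w.
  by apply: wF; exists [:: a], M; split=> // a'; rewrite mem_seq1 => /eqP->.
move=> [_ [h' [wh' _]]]; rewrite wh in wh'.
by rewrite -(coords_untup_inj wh'); exact.
Qed.

End Few.

Lemma homology_card K (b : 'I_K -> 'Z_l) : ~ finitely_covered G n p b ->
  ([set: H] #= [set: k])%card.
Proof.
move=> ncov; rewrite card_eq_le; apply/andP; split.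
  by apply: embeds_card_le; exact: homology_embeds.
apply: embeds_card_le; apply: contrapT => kH; apply: ncov.
have /boolp.choice[rep repP] : forall a : H, exists h, has_cycle b a ->
    exists hc : cycle b h, homology_class (BarCycle hc) = a.
  move=> a; have [[h [hc ha]]|N] := pselect (has_cycle b a).
    by exists h => _; exists hc.
  by exists (fun=> [tuple 1%g | i < n]).
exact: few_finitely_covered repP.
Qed.

End NotCovered.

(** * The dichotomy *)

Local Open Scope card_scope.

Theorem theoremC (G : affine_group_scheme)
    (hG : integral_form_of_connected_reductive G)
    (n l p : nat) (hl : prime l) (hp : prime p \/ p = 0%N) (hpl : p <> l) :
  ((forall k : closedFieldType, has_char k p ->
      countable [set: homology 'Z_l (points G k) n])
   /\ (exists isop : nat -> nat,
        forall k : closedFieldType, has_char k p ->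
          isoperimetric_function 'Z_l (points G k) n isop)
   /\ (forall (k K : closedFieldType) (iota : {rmorphism k -> K}),
        has_char k p -> has_char K p ->
        is_isomorphism
          (homology_map 'Z_l (points_map G iota) n)))
  \/
  (forall k : closedFieldType, has_char k p -> ~ countable [set: k] ->
     [set: homology 'Z_l (points G k) n] #= [set: k]).
Proof.
have [m [gen genS]] := finite_type_generators hG.1.
have [cov|] := pselect (forall K (b : 'I_K -> 'Z_l), finitely_covered G n p b).
  left; split; [|split] => [k kp||k K iota kp Kp].
  - exact (homology_countable cov kp).
  - exact (isoperimetric_function_exists genS cov).
  - exact (homology_map_bijective genS cov iota kp Kp).
move=> /existsNP[K /existsNP[b ncov]]; right => k kp knc.
exact (homology_card genS kp knc ncov).
Qed.
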